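(* Let $V$ be a simple vertex operator superalgebra and let $G$ be a finite solvable subgroup of $\mathrm{Aut}(V)$. Suppose that $V^G=\{v\in V: hv=v\text{ for all }h\in G\}$ is rational. Then $V$ is $g$-rational for every $g\in G$.
   Context: Vertex operator superalgebra: a super vector space $V=V_{\bar 0}\oplus V_{\bar 1}$ over $\mathbb C$ with a grading $V=\bigoplus_{n\in\frac12\mathbb Z}V_n$, $V_{\bar0}=\bigoplus_{n\in\mathbb Z}V_n$, $V_{\bar1}=\bigoplus_{n\in\frac12+\mathbb Z}V_n$, $\dim V_n<\infty$, $V_n=0$ for $n\ll0$, with vacuum $\mathbf 1\in V_0$, conformal vector $\omega\in V_2$ and a vertex operator map $Y(v,z)=\sum_{n\in\mathbb Z}v_nz^{-n-1}$ satisfying the usual axioms with the super Jacobi identity (a sign $(-1)^{ij}$ when $u\in V_{\bar i}$, $v\in V_{\bar j}$ are interchanged); $Y(\omega,z)=\sum_n L(n)z^{-n-2}$ and $L(0)=n$ on $V_n$. $V$ is simple if it has no nonzero proper ideals. $\mathrm{Aut}(V)$ is the group of linear automorphisms $g$ with $gY(v,z)g^{-1}=Y(gv,z)$, $g\mathbf 1=\mathbf 1$, $g\omega=\omega$. Let $\sigma\in\mathrm{Aut}(V)$ act as $(-1)^i$ on $V_{\bar i}$. The fixed-point space $V^G$ is itself a vertex operator superalgebra. Twisted modules: let $g\in\mathrm{Aut}(V)$ have finite order $T$, and let $T'$ be the order of $g\sigma$. A weak $g$-twisted $V$-module is a vector space $M$ with a linear map $v\mapsto Y_M(v,z)=\sum_{n\in\frac1T\mathbb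 Z}v_nz^{-n-1}$, $v_n\in\mathrm{End}(M)$, such that: for each $v\in V,w\in M$, $v_nw=0$ for $n\gg0$; $Y_M(\mathbf 1,z)=\mathrm{Id}_M$; if $gu=e^{2\pi i r/T}u$ then $Y_M(u,z)=\sum_{n\in\frac rT+\mathbb Z}u_nz^{-n-1}$; and for such $u\in V_{\bar i}$ and $v\in V_{\bar j}$, $$z_0^{-1}\delta\Big(\frac{z_1-z_2}{z_0}\Big)Y_M(u,z_1)Y_M(v,z_2)-(-1)^{ij}z_0^{-1}\delta\Big(\frac{z_2-z_1}{-z_0}\Big)Y_M(v,z_2)Y_M(u,z_1)=z_2^{-1}\Big(\frac{z_1-z_0}{z_2}\Big)^{-r/T}\delta\Big(\frac{z_1-z_0}{z_2}\Big)Y_M(Y(u,z_0)v,z_2).$$ An admissible $g$-twisted $V$-module is a weak $g$-twisted module with a grading $M=\bigoplus_{n\in\frac1{T'}\mathbb Z_{\ge0}}M(n)$ such that $v_mM(n)\subset M(n+\mathrm{wt}\,v-m-1)$ for homogeneous $v$. $V$ is $g$-rational if every admissible $g$-twisted $V$-module is a direct sum of irreducible admissible $g$-twisted $V$-modules; rational means $1$-rational (so $V^G$ is rational if its admissible (untwisted) modules are completely reducible). *)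

(* Defs.v *)
(* The complex numbers are R[i] for R : realType. *)
From HB Require Import structures.
From mathcomp Require Import all_boot all_order all_algebra.
From mathcomp Require Import all_fingroup all_solvable.
From mathcomp Require Import complex.
From mathcomp Require Import boolp classical_sets functions cardinality fsbigop.
From mathcomp Require Import reals trigo.

Set Implicit Arguments.
Unset Strict Implicit.
Unset Printing Implicit Defensive.

Import Order.TTheory GRing.Theory Num.Theory.

Local Open Scope classical_set_scope.
Local Open Scope ring_scope.
Local Open Scope complex_scope.

Section LinearAlgebra.
Context {C : fieldType} {W : lmodType C}.

Definition subspace (U : set W) : Prop :=
  U 0 /\ forall (a : C) u v, U u -> U v -> U (a *: u + v).

Definition fin_dim (U : set W) : Prop :=
  exists (n : nat) (b : 'I_n -> W), (forall i, U (b i)) /\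
    forall u, U u -> exists c : 'I_n -> C, u = \sum_i c i *: b i.

Definition sumspace {I : choiceType} (U : I -> set W) : set W :=
  [set w | exists (s : seq I) (f : I -> W),
     [/\ uniq s, forall i, i \in s -> U i (f i) & w = \sum_(i <- s) f i]].

Definition direct_sum {I : choiceType} (U : I -> set W) : Prop :=
  [/\ forall i, subspace (U i),
      sumspace U = setT
    & forall (s : seq I) (f : I -> W), uniq s ->
        (forall i, i \in s -> U i (f i)) ->
        \sum_(i <- s) f i = 0 -> forall i, i \in s -> f i = 0].

(* W is the direct sum of the gr n for n in P; gr is extended by 0 outside P *)
Definition grading (P : set rat) (gr : rat -> set W) : Prop :=
  direct_sum gr /\ forall n, ~ P n -> gr n `<=` [set 0].

Lemma subspaceZ (U : set W) a u : subspace U -> U u -> U (a *: u).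
Proof. by case=> U0 UD Uu; rewrite -[_ *: _]addr0; apply: UD. Qed.

Lemma subspaceD (U : set W) u v : subspace U -> U u -> U v -> U (u + v).
Proof. by case=> U0 UD Uu Uv; rewrite -[u]scale1r; apply: UD. Qed.

End LinearAlgebra.

(* n belongs to a + Z *)
Definition in_coset (a n : rat) : Prop := (n - a) \is a Num.int.

Section FormalCalculus.
Context {C : numClosedFieldType}.

Definition qbinom (a : rat) (k : nat) : rat :=
  (\prod_(j < k) (a - j%:R)) / k`!%:R.

(* Mono x a b c is the monomial x z0^a z1^b z2^c *)
Record monomial := Mono { mcoef : rat; mexp0 : rat; mexp1 : rat; mexp2 : rat }.

(* A formal series in z0, z1, z2 with coefficients in M (rational exponents) is
   the function sending (a, b, c) to the coefficient of z0^a z1^b z2^c.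
   [mulK K F] is the product of the formal sum of the monomials K (n, k),
   (n, k) in Z x N, with the series F; the sum is the finite-support sum. *)
Definition mulK {M : lmodType C} (K : int * nat -> monomial)
    (F : rat -> rat -> rat -> M) (a b c : rat) : M :=
  \sum_(p \in [set: int * nat])
    ratr (mcoef (K p)) *:
      F (a - mexp0 (K p)) (b - mexp1 (K p)) (c - mexp2 (K p)).

(* The expansions below use the binomial convention
   (x - y)^m = \sum_(k >= 0) 'C(m, k) (-1)^k x^(m-k) y^k. *)

(* z0^-1 delta((z1 - z2) / z0) = \sum_n z0^(-n-1) (z1 - z2)^n *)
Definition delta12 (p : int * nat) : monomial :=
  let n : rat := p.1%:~R in let k := p.2 in
  Mono ((-1) ^+ k * qbinom n k) (- n - 1) (n - k%:R) k%:R.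

(* z0^-1 delta((z2 - z1) / - z0) = \sum_n (-1)^n z0^(-n-1) (z2 - z1)^n *)
Definition delta21 (p : int * nat) : monomial :=
  let n : rat := p.1%:~R in let k := p.2 in
  Mono ((-1) ^ p.1 * ((-1) ^+ k * qbinom n k)) (- n - 1) k%:R (n - k%:R).

(* z2^-1 ((z1 - z0) / z2)^-al delta((z1 - z0) / z2)
     = \sum_n z2^(-1-(n-al)) (z1 - z0)^(n-al) *)
Definition delta10 (al : rat) (p : int * nat) : monomial :=
  let m : rat := p.1%:~R - al in let k := p.2 in
  Mono ((-1) ^+ k * qbinom m k) k%:R (m - k%:R) (- 1 - m).

(* Modes: Y u n is the coefficient u_n of z^(-n-1) in Y(u, z). *)
Definition jacobi {V M : lmodType C} (Y : V -> rat -> V -> V)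
    (YM : V -> rat -> M -> M) (al : rat) (i j : bool) (u v : V) : Prop :=
  forall (w : M) (a b c : rat),
    mulK delta12 (fun a b c =>
        if a == 0 then YM u (- b - 1) (YM v (- c - 1) w) else 0) a b c
    - (-1) ^+ (i && j) *:
    mulK delta21 (fun a b c =>
        if a == 0 then YM v (- c - 1) (YM u (- b - 1) w) else 0) a b c
    = mulK (delta10 al) (fun a b c =>
        if b == 0 then YM (Y u (- a - 1) v) (- c - 1) w else 0) a b c.

End FormalCalculus.

Section Parity.
Context {C : fieldType} {V : lmodType C}.

(* V_{i-bar}: the sum of the V_n with n in i/2 + Z *)
Definition parity (gr : rat -> set V) (i : bool) : set V :=
  sumspace (fun n => [set v | in_coset (i%:R / 2%:R) n /\ gr n v]).

End Parity.

Section VOSA.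
Context {R : realType}.
Local Notation C := R[i].

(* L(n) = omega_(n+1) *)
Definition virasoro {V : lmodType C} (Y : V -> rat -> V -> V) (om : V)
    (n : int) (v : V) : V := Y om (n%:~R + 1) v.

(* vgr n is V_n; V_n is put to 0 for n outside (1/2)Z, and likewise for the
   modes v_n outside Z. *)
Record vosa := Vosa {
  vcar :> lmodType C;
  vgr : rat -> set vcar;
  vY : vcar -> rat -> vcar -> vcar;
  vac : vcar;
  omega : vcar;
  vgr_grading : grading [set n | (2%:R * n) \is a Num.int] vgr;
  vgr_fin_dim : forall n, fin_dim (vgr n);
  vgr_bounded : exists N : rat, forall n, n < N -> vgr n `<=` [set 0];
  vac_wt : vgr 0 vac;
  omega_wt : vgr 2%:R omega;
  vY_linl : forall n w, linear (fun v => vY v n w);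
  vY_linr : forall v n, linear (vY v n);
  vY_int : forall v n w, n \isn't a Num.int -> vY v n w = 0;
  vY_trunc : forall v w, exists N : rat, forall n, N <= n -> vY v n w = 0;
  vY_vac : forall n w, vY vac n w = if n == -1 then w else 0;
  vY_create : forall v, vY v (-1) vac = v;
  vY_create0 : forall v (n : nat), vY v n%:R vac = 0;
  vY_jacobi : forall (i j : bool) u v,
    parity vgr i u -> parity vgr j v -> jacobi vY vY 0 i j u v;
  vY_virasoro : exists cc : C, forall (m n : int) v,
    virasoro vY omega m (virasoro vY omega n v)
    - virasoro vY omega n (virasoro vY omega m v)
    = (m - n)%:~R *: virasoro vY omega (m + n) v
      + (if m + n == 0 then ((m ^+ 3 - m)%:~R / 12%:R * cc) *: v else 0);
  vY_deriv : forall v n w,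
    vY (virasoro vY omega (-1) v) n w = - (ratr n *: vY v (n - 1) w);
  vY_L0 : forall n v, vgr n v -> virasoro vY omega 0 v = ratr n *: v
}.

Definition ideal (V : vosa) (I : set V) : Prop :=
  subspace I /\
  forall (u v : V) (n : rat), I v -> I (vY u n v) /\ I (vY v n u).

Definition simple_vosa (V : vosa) : Prop :=
  forall I : set V, ideal I -> I = [set 0] \/ I = setT.

Record aut (V : vosa) := Aut {
  afun :> V -> V;
  aut_linear : linear afun;
  aut_bij : bijective afun;
  aut_Y : forall u n v, afun (vY u n v) = vY (afun u) n (afun v);
  aut_vac : afun (vac V) = vac V;
  aut_omega : afun (omega V) = omega V
}.

Lemma id_linear (V : vosa) : linear (@id V).
Proof. by []. Qed.

Definition id_aut (V : vosa) : aut V :=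
  Aut (@id_linear V) (inv_bij (fun=> erefl)) (fun _ _ _ => erefl) erefl erefl.

(* G is the image of a finite solvable group under an injective homomorphism
   into Aut(V) *)
Definition finite_solvable_subgroup (V : vosa) (G : set (aut V)) : Prop :=
  exists (gT : finGroupType) (H : {group gT}) (rho : gT -> aut V),
    [/\ solvable H,
        {in H &, forall x y, rho (x * y)%g =1 rho x \o rho y},
        {in H &, forall x y, rho x =1 rho y -> x = y}
      & G = [set rho x | x in [set x | x \in H]]].

(* v = a + b with a even and b odd is sent to a - b *)
Definition sigma (V : vosa) (v : V) : V :=
  xget 0 [set x | exists a b : V,
    [/\ parity (@vgr V) false a, parity (@vgr V) true b, v = a + b & x = a - b]].

Definition is_order {X : Type} (g : X -> X) (T : nat) : Prop :=
  [/\ (0 < T)%N, iter T g =1 id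
    & forall k, (0 < k < T)%N -> ~ (iter k g =1 id)].

Definition cis (t : R) : C := cos t +i* sin t.

(* e^(2 pi i r / T) *)
Definition root_exp (r : int) (T : nat) : C :=
  cis (2%:R * pi * r%:~R / T%:R).

Record weak_twisted (V : vosa) (g : aut V) (T : nat) := WeakTwisted {
  mcar :> lmodType C;
  mY : V -> rat -> mcar -> mcar;
  mY_linl : forall n w, linear (fun v => mY v n w);
  mY_linr : forall v n, linear (mY v n);
  mY_frac : forall v n w, (T%:R * n) \isn't a Num.int -> mY v n w = 0;
  mY_trunc : forall v w, exists N : rat, forall n, N <= n -> mY v n w = 0;
  mY_vac : forall n w, mY (vac V) n w = if n == -1 then w else 0;
  mY_eigen : forall (r : int) (u : V), g u = root_exp r T *: u ->
    forall n w, ~ in_coset (r%:~R / T%:R) n -> mY u n w = 0;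
  mY_jacobi : forall (r : int) (i j : bool) (u v : V),
    g u = root_exp r T *: u ->
    parity (@vgr V) i u -> parity (@vgr V) j v ->
    jacobi (@vY V) mY (r%:~R / T%:R) i j u v
}.

Record admissible_twisted (V : vosa) (g : aut V) (T T' : nat) := Admissible {
  amod :> weak_twisted g T;
  mgr : rat -> set amod;
  mgr_grading : grading [set n | exists k : nat, n = k%:R / T'%:R] mgr;
  mgr_Y : forall (d : rat) (v : V) (m n : rat) (w : amod),
    vgr d v -> mgr n w -> mgr (n + d - m - 1) (mY v m w)
}.

Section Submodules.
Context {V : vosa} {g : aut V} {T T' : nat} (M : admissible_twisted g T T').

Definition admissible_submodule (N : set M) : Prop :=
  [/\ subspace N,
      forall (v : V) (n : rat) (w : M), N w -> N (mY v n w)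
    & N `<=` sumspace (fun n => @mgr _ _ _ _ M n `&` N)].

Definition irreducible_submodule (N : set M) : Prop :=
  [/\ admissible_submodule N,
      N <> [set 0]
    & forall N' : set M, admissible_submodule N' -> N' `<=` N ->
        N' = [set 0] \/ N' = N].

(* A direct sum of irreducible admissible modules is taken internally: the
   summands are submodules of M graded by the M(n). *)
Definition completely_reducible : Prop :=
  exists (I : choiceType) (N : I -> set M),
    (forall i, irreducible_submodule (N i)) /\ direct_sum N.

End Submodules.

(* T is the order of g and T' the order of g sigma *)
Definition g_rational (V : vosa) (g : aut V) : Prop :=
  exists T T' : nat,
    [/\ is_order g T, is_order (g \o @sigma V) T'
      & forall M : admissible_twisted g T T', completely_reducible M].

Definition rational_vosa (V : vosa) : Prop := g_rational (id_aut V).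

Section LinearFacts.
Context {A B : lmodType C} (f : A -> B) (lf : linear f).

Lemma lin0 : f 0 = 0.
Proof. by have := lf (-1) 0 0; rewrite scaler0 addr0 scaleN1r addNr. Qed.

Lemma linZ a x : f (a *: x) = a *: f x.
Proof. by have := lf a x 0; rewrite lin0 !addr0. Qed.

Lemma linD x y : f (x + y) = f x + f y.
Proof. by have := lf 1 x y; rewrite !scale1r. Qed.

Lemma linB x y : f (x - y) = f x - f y.
Proof. by rewrite -scaleN1r linD linZ scaleN1r. Qed.

Lemma lin_sum (I : Type) (s : seq I) (F : I -> A) :
  f (\sum_(i <- s) F i) = \sum_(i <- s) f (F i).
Proof. by elim/big_rec2: _ => [|i y x _ <-]; rewrite ?lin0 ?linD. Qed.

Lemma mulK_lin (inj : injective f) (K : int * nat -> monomial)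
    (F : rat -> rat -> rat -> A) a b c :
  f (mulK K F a b c) = mulK K (fun a b c => f (F a b c)) a b c.
Proof.
rewrite /mulK lin_sum.
set G := fun p => _ *: F _ _ _.
set G' := fun p => _ *: f (F _ _ _).
have GG' p : f (G p) = G' p by rewrite /G linZ.
have -> : finite_support 0 [set: int * nat] G' =
          finite_support 0 [set: int * nat] G.
  rewrite /finite_support !unlock.
  suff -> : [set: int * nat] `&` G' @^-1` [set~ 0] =
            [set: int * nat] `&` G @^-1` [set~ 0] by [].
  apply/seteqP; split=> p [_ /= h]; split=> // h0; apply: h.
    by rewrite -GG' h0 lin0.
  by apply: inj; rewrite lin0 GG'.
by apply: eq_bigr => p _; exact: GG'.
Qed.

End LinearFacts.

Section Independence.
Context {W : lmodType C} {I : choiceType} (U : I -> set W) (dU : direct_sum U).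

Lemma direct_sum_eq (s s' : seq I) (f f' : I -> W) :
    uniq s -> uniq s' ->
    (forall i, i \in s -> U i (f i)) -> (forall i, i \in s' -> U i (f' i)) ->
    \sum_(i <- s) f i = \sum_(i <- s') f' i ->
  forall i, (if i \in s then f i else 0) = (if i \in s' then f' i else 0).
Proof.
case: dU => subU _ indU us us' Uf Uf' eqs i.
pose t := undup (s ++ s').
pose h j := (if j \in s then f j else 0) - (if j \in s' then f' j else 0).
have sumE (r : seq I) (k : I -> W) : uniq r -> {subset r <= t} ->
    \sum_(j <- t) (if j \in r then k j else 0) = \sum_(j <- r) k j.
  move=> ur rt; rewrite -big_mkcond -big_filter; apply: perm_big.
  apply: uniq_perm => //; first by rewrite filter_uniq // undup_uniq.
  by move=> j; rewrite mem_filter; case jr: (j \in r) => //=; rewrite rt.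
have st : {subset s <= t} by move=> j js; rewrite mem_undup mem_cat js.
have st' : {subset s' <= t} by move=> j js; rewrite mem_undup mem_cat js orbT.
have h0 : \sum_(j <- t) h j = 0.
  by rewrite /h sumrB !sumE // eqs subrr.
have Uh j : U j (h j).
  have [U0 UD] := subU j; rewrite /h addrC -scaleN1r; apply: UD.
    by case: ifP => // /Uf'.
  by case: ifP => // /Uf.
apply/eqP; rewrite -subr_eq0 -/(h i); apply/eqP.
case it: (i \in t); first by apply: (indU t h) => //; exact: undup_uniq.
move: it; rewrite mem_undup mem_cat => /negbT; rewrite negb_or => /andP[a b].
by rewrite /h (negbTE a) (negbTE b) subrr.
Qed.

End Independence.

Lemma fin_dim_sub {W : lmodType C} (U U' : set W) :
  fin_dim U -> U' `<=` U -> fin_dim U'.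
Proof.
move=> [n [b [_ bU]]] U'U.
pose comb (x : 'rV[C]_n) : W := \sum_i x 0 i *: b i.
suff [m [A [AU' full]]] : exists m (A : 'M[C]_(m, n)),
    (forall i, U' (comb (row i A))) /\
    forall x, U' (comb x) -> (x <= A)%MS.
  exists m, (fun i => comb (row i A)); split=> // u U'u.
  have [c uE] := bU _ (U'U _ U'u).
  pose x : 'rV_n := \row_i c i.
  have ux : u = comb x.
    by rewrite uE /comb; apply: eq_bigr => i _; rewrite mxE.
  have /submxP[y xy] : (x <= A)%MS by apply: full; rewrite -ux.
  exists (y 0); rewrite ux xy /comb.
  under [RHS]eq_bigr do rewrite scaler_sumr.
  rewrite exchange_big; apply: eq_bigr => i _; rewrite mxE scaler_suml.
  by apply: eq_bigr => j _; rewrite mxE scalerA.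
suff IH : forall k m (A : 'M[C]_(m, n)), (n - \rank A <= k)%N ->
    (forall i, U' (comb (row i A))) -> exists m (A : 'M[C]_(m, n)),
    (forall i, U' (comb (row i A))) /\ forall x, U' (comb x) -> (x <= A)%MS.
  by apply: (IH n 0%N 0) => [|[]//]; rewrite leq_subr.
elim=> [|k IH] m A rA AU'.
  exists m, A; split=> // x _; apply: submx_full.
  by rewrite /row_full eqn_leq rank_leq_col -subn_eq0 -leqn0.
have [full|] := pselect (forall x, U' (comb x) -> (x <= A)%MS).
  by exists m, A.
move=> /existsNP[x /not_implyP[U'x /negP nxA]].
apply: (IH _ (col_mx A x)).
  have lt : (\rank A < \rank (col_mx A x))%N.
    rewrite -(addsmxE A x); apply: rank_ltmx; rewrite ltmxE addsmxSl /=.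
    apply: contra nxA => h.
    exact: submx_trans (addsmxSr A x) h.
  by rewrite -ltnS; apply: leq_trans rA; apply: ltn_sub2l => //;
     apply: leq_trans lt (rank_leq_col _).
move=> i; case: (split_ordP i) => j ->.
  by rewrite rowKu.
by rewrite rowKd (_ : row j x = x) //; apply/rowP => l; rewrite mxE ord1.
Qed.

Section Fixed.
Context (V : vosa) (S : set (aut V)).

Lemma vgr_L0 n v : vgr n v <-> virasoro (@vY V) (omega V) 0 v = ratr n *: v.
Proof.
split; first exact: vY_L0.
have dV : direct_sum (@vgr V) by case: (vgr_grading V).
have [subV + indV] := dV => /seteqP[_ /(_ v I)] [s [f [us sf ->]]].
rewrite /virasoro lin_sum; last exact: vY_linr.
move=> E.
have {E} : \sum_(i <- s) (ratr i - ratr n : C) *: f i = 0.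
  under eq_bigr do rewrite scalerBl.
  rewrite sumrB -scaler_sumr -E; apply/eqP; rewrite subr_eq0; apply/eqP.
  by apply: eq_big_seq => i /sf /vY_L0.
move=> /(indV _ _ us) z.
have fz i : i \in s -> i != n -> f i = 0.
  move=> is_ /negP ne.
  have /eqP := z (fun i is_ => subspaceZ (ratr i - ratr n) (subV i) (sf i is_)) i is_.
  rewrite scaler_eq0 subr_eq0 => /orP[/eqP/fmorph_inj/eqP//|/eqP//].
rewrite big_seq; elim/big_rec: _ => [|i x is_ Vx]; first by case: (subV n).
have [ei|ne] := eqVneq i n; last by rewrite fz // add0r.
by apply: subspaceD Vx; [exact: subV|rewrite -{1}ei; exact: sf].
Qed.

Lemma aut_vgr (h : aut V) n v : vgr n v -> vgr n (h v).
Proof.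
move=> /vgr_L0 E; apply/vgr_L0; move: E; rewrite /virasoro => E.
by rewrite -[in LHS](aut_omega h) -aut_Y E; exact: linZ (aut_linear h) _ _.
Qed.

Definition fixed : {pred V} := fun v => `[< forall h : aut V, S h -> h v = v >].

Lemma fixedP v : reflect (forall h : aut V, S h -> h v = v) (v \in fixed).
Proof. exact: asboolP. Qed.

Lemma fixed_submod : submod_closed fixed.
Proof.
split=> [|a u v /fixedP hu /fixedP hv]; apply/fixedP => h Sh.
  exact: lin0 (aut_linear h).
by rewrite (aut_linear h) hu // hv.
Qed.

HB.instance Definition _ := GRing.isSubmodClosed.Build C V fixed fixed_submod.

Record fixed_pts := FixedPts { fval : V; fvalP : fval \in fixed }.
HB.instance Definition _ := [isSub for fval].
HB.instance Definition _ := [Choice of fixed_pts by <:].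
HB.instance Definition _ := [SubChoice_isSubLmodule of fixed_pts by <:].

Lemma fvalK v (hv : v \in fixed) : fval (FixedPts hv) = v.
Proof. by []. Qed.

Lemma fval_linear : linear fval.
Proof. move=> a u v; exact: (linearP (val : fixed_pts -> V)). Qed.

Lemma fval_inj : injective fval.
Proof. exact: val_inj. Qed.

Lemma fixed_vac : vac V \in fixed.
Proof. by apply/fixedP => h _; exact: aut_vac. Qed.

Lemma fixed_omega : omega V \in fixed.
Proof. by apply/fixedP => h _; exact: aut_omega. Qed.

Lemma fixed_Y u n v : u \in fixed -> v \in fixed -> vY u n v \in fixed.
Proof.
move=> /fixedP hu /fixedP hv; apply/fixedP => h Sh.
by rewrite aut_Y hu // hv.
Qed.

Definition fgr (n : rat) : set fixed_pts := [set v | vgr n (fval v)].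

Definition fY (u : fixed_pts) (n : rat) (v : fixed_pts) : fixed_pts :=
  FixedPts (fixed_Y n (fvalP u) (fvalP v)).

Lemma fgr_grading : grading [set n | (2%:R * n) \is a Num.int] fgr.
Proof.
have [dV zV] := vgr_grading V; have [subV decV indV] := dV.
split; last by move=> n nP v /(zV _ nP) v0; apply: fval_inj; rewrite v0 (lin0 fval_linear).
split.
- move=> n; have [V0 VD] := subV n; split.
    by rewrite -[fgr n _]/(vgr n (fval _)) (lin0 fval_linear).
  move=> a u v Vu Vv; rewrite -[fgr n _]/(vgr n (fval _)) fval_linear.
  exact: VD.
- apply/seteqP; split=> // v _.
  have [s [f [us sf vE]]] : sumspace (@vgr V) (fval v) by rewrite decV.
  have ff i : i \in s -> f i \in fixed.
    move=> is_; apply/fixedP => h Sh.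
    have sE : \sum_(i <- s) (h (f i)) = \sum_(i <- s) f i.
      rewrite -lin_sum; last exact: aut_linear.
      by rewrite -vE; have /fixedP := fvalP v; apply.
    have := direct_sum_eq dV us us (fun i is_ => aut_vgr h (sf i is_)) sf sE i.
    by rewrite is_.
  exists s, (fun i => insubd 0 (f i)); split=> //.
    by move=> i is_; rewrite -[fgr i _]/(vgr i (val _)) (insubdK _ (ff i is_)); exact: sf.
  apply: fval_inj; rewrite lin_sum; last exact: fval_linear.
  by rewrite vE; apply: eq_big_seq => i is_; rewrite (insubdK _ (ff i is_)).
- move=> s f us sf s0 i is_; apply: fval_inj; rewrite (lin0 fval_linear).
  apply: (indV s (fun i => fval (f i))) => //.
  by rewrite -lin_sum ?s0 ?(lin0 fval_linear) //; exact: fval_linear.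
Qed.

Lemma fgr_fin_dim n : fin_dim (fgr n).
Proof.
have [] := fin_dim_sub (U' := fval @` fgr n) (vgr_fin_dim V n).
  by move=> _ [v Vv <-].
move=> k [b [bU bs]].
have bf i : b i \in fixed by have [v _ <-] := bU i; exact: fvalP.
exists k, (fun i => FixedPts (bf i)); split.
  by move=> i; rewrite /fgr /=; have [v Vv <-] := bU i.
move=> u Vu; have [|c uE] := bs (fval u); first by exists u.
exists c; apply: fval_inj; rewrite uE lin_sum; last exact: fval_linear.
by apply: eq_bigr => i _; rewrite linZ //; exact: fval_linear.
Qed.

Lemma fparity i v : parity fgr i v -> parity (@vgr V) i (fval v).
Proof.
move=> [s [f [us sf ->]]]; exists s, (fun i => fval (f i)); split=> //.
by apply: lin_sum; exact: fval_linear.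
Qed.

Lemma fY_jacobi (i j : bool) u v :
  parity fgr i u -> parity fgr j v -> jacobi fY fY 0 i j u v.
Proof.
move=> /fparity pu /fparity pv w a b c; apply: fval_inj.
rewrite (linB fval_linear) (linZ fval_linear) !(mulK_lin fval_linear fval_inj).
have := vY_jacobi pu pv (fval w) a b c.
set L1 := mulK delta12 _; set L2 := mulK delta21 _; set L3 := mulK _ _.
set R1 := mulK delta12 _; set R2 := mulK delta21 _; set R3 := mulK _ _.
have -> : L1 = R1.
  by congr mulK; do 3!apply: funext => ?; case: ifP => //; rewrite (lin0 fval_linear).
have -> : L2 = R2.
  by congr mulK; do 3!apply: funext => ?; case: ifP => //; rewrite (lin0 fval_linear).
have -> // : L3 = R3.
by congr mulK; do 3!apply: funext => ?; case: ifP => //; rewrite (lin0 fval_linear).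
Qed.

Definition fixed_vosa : vosa.
Proof.
apply: (@Vosa fixed_pts fgr fY (FixedPts fixed_vac) (FixedPts fixed_omega)
  fgr_grading fgr_fin_dim).
- have [N HN] := vgr_bounded V; exists N => n /HN h v /h v0.
  by apply: fval_inj; rewrite v0 (lin0 fval_linear).
- exact: vac_wt.
- exact: omega_wt.
- by move=> n w a u v; apply: fval_inj; rewrite fval_linear /=; exact: vY_linl.
- by move=> n w a u v; apply: fval_inj; rewrite fval_linear /=; exact: vY_linr.
- by move=> v n w nn; apply: fval_inj; rewrite (lin0 fval_linear); exact: vY_int.
- move=> v w; have [N HN] := vY_trunc (fval v) (fval w); exists N => n /HN h.
  by apply: fval_inj; rewrite (lin0 fval_linear).
- move=> n w; apply: fval_inj; rewrite [LHS]vY_vac.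
  by case: ifP => //; rewrite (lin0 fval_linear).
- by move=> v; apply: fval_inj; exact: vY_create.
- by move=> v n; apply: fval_inj; rewrite (lin0 fval_linear); exact: vY_create0.
- exact: fY_jacobi.
- have [cc H] := vY_virasoro V; exists cc => m n v; apply: fval_inj.
  rewrite (linB fval_linear) (linD fval_linear) (linZ fval_linear).
  have := H m n (fval v); rewrite /virasoro /= => ->; congr (_ + _).
  by case: ifP => _; rewrite ?(lin0 fval_linear) ?(linZ fval_linear).
- move=> v n w; apply: fval_inj.
  by rewrite -scaleN1r !(linZ fval_linear) scaleN1r; exact: vY_deriv.
- by move=> n v Vv; apply: fval_inj; rewrite (linZ fval_linear); exact: vY_L0.
Defined.

End Fixed.

Section SigmaFacts.
Context (V : vosa).

Lemma parity_lin i (a : C) (u v : V) :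
  parity (@vgr V) i u -> parity (@vgr V) i v -> parity (@vgr V) i (a *: u + v).
Proof.
move=> [s [f [us sf ->]]] [s' [f' [us' sf' ->]]].
pose h j := a *: (if j \in s then f j else 0) + (if j \in s' then f' j else 0).
have [[subV _ _] _] := vgr_grading V.
exists (undup (s ++ s')), h; split; first exact: undup_uniq.
  move=> j jt; have [V0 VD] := subV j; split; last first.
    by apply: VD; case: ifP => // js; [case: (sf _ js)|case: (sf' _ js)].
  by move: jt; rewrite mem_undup mem_cat => /orP[js|js]; [case: (sf _ js)|case: (sf' _ js)].
have sumE (r : seq rat) (k : rat -> V) : uniq r -> {subset r <= s ++ s'} ->
    \sum_(j <- r) k j = \sum_(j <- undup (s ++ s')) (if j \in r then k j else 0).
  move=> ur rt; rewrite -big_mkcond -[RHS]big_filter; apply: perm_big.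
  apply: uniq_perm => //; first by rewrite filter_uniq // undup_uniq.
  move=> j; rewrite mem_filter mem_undup.
  by case jr: (j \in r) => //=; rewrite rt.
rewrite (sumE s) // ?(sumE s') //; first by rewrite scaler_sumr -big_split.
  by move=> j js; rewrite mem_cat js orbT.
by move=> j js; rewrite mem_cat js.
Qed.

Lemma parity0 i : parity (@vgr V) i 0.
Proof. by exists [::], (fun=> 0); split=> //; rewrite big_nil. Qed.

Lemma parity_disj (v : V) :
  parity (@vgr V) false v -> parity (@vgr V) true v -> v = 0.
Proof.
move=> [s [f [us sf vE]]] [s' [f' [us' sf' vE']]].
have [dV _] := vgr_grading V.
have E := direct_sum_eq dV us us' (fun i is_ => (sf i is_).2)
  (fun i is_ => (sf' i is_).2) (etrans (esym vE) vE').
rewrite vE big_seq; apply: big1 => i is_; have := E i; rewrite is_.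
case: ifP => // is' _; have [c1 _] := sf' i is'; have [c0 _] := sf i is_.
have : (1 / 2%:R : rat) \is a Num.int.
  move: c0 c1; rewrite /in_coset /= mulr0n mul0r subr0 => ci ci'.
  by rewrite -[1 / _](subKr i) rpredB.
by [].
Qed.

Lemma sigma_parity (i : bool) (v : V) :
  parity (@vgr V) i v -> sigma v = (-1) ^+ i *: v.
Proof.
move=> pv; apply: xget_unique.
  case: i pv => pv; [exists 0, v|exists v, 0]; split=> //; try exact: parity0.
  - by rewrite add0r.
  - by rewrite expr1 scaleN1r sub0r.
  - by rewrite addr0.
  - by rewrite expr0 scale1r subr0.
move=> x [a [b [pa pb vE ->]]]; case: i pv => pv.
  have a0 : a = 0.
    apply: parity_disj => //.
    by rewrite (_ : a = -1 *: b + v); [exact: parity_lin|rewrite vE scaleN1r addrC addrK].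
  by rewrite expr1 vE a0 sub0r add0r scaleN1r.
have b0 : b = 0.
  apply: parity_disj => //.
  by rewrite (_ : b = -1 *: a + v); [exact: parity_lin|rewrite vE scaleN1r addKr].
by rewrite expr0 vE b0 subr0 addr0 scale1r.
Qed.

End SigmaFacts.
End VOSA.
Arguments vosa R : clear implicits.

(* Main.v *)
(* Let M be an admissible g-twisted V-module and U a submodule. Rationality of V^G
   gives a V^G-linear projection p of M onto U, to be averaged into a V-linear one
   as for a Galois extension of algebras: if \sum_i x_i h(y_i) is 1 for h = 1 and 0
   for the other h in G, then \sum_i x_i p y_i is V-linear. Such x_i and y_i, with
   products replaced by modes, exist by an independence argument of Artin type in
   the simple algebra V. To avoid convergence questions, p is extended to the
   relation "p (\sum_h (h a)_n x_h) = \sum_h (h a)_n y_h for all a and n" between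
   families (x_h), (y_h) in M; it is stable under the modes of V and it is the
   graph of a map. *)
From HB Require Import structures.
From mathcomp Require Import all_boot all_order all_algebra.
From mathcomp Require Import all_fingroup.
From mathcomp Require Import complex.
From mathcomp Require Import boolp classical_sets functions cardinality fsbigop.
From mathcomp Require Import reals trigo.
From mathcomp Require Import ring lra zify.
Require Import Defs.

Set Implicit Arguments.
Unset Strict Implicit.
Unset Printing Implicit Defensive.

Import Order.TTheory GRing.Theory Num.Theory.

Local Open Scope classical_set_scope.
Local Open Scope ring_scope.
Local Open Scope complex_scope.

(** * Binomial series *)

Section Binomials.

(** Modes do not multiply associatively: a product u_m v_n and an iterate (u_k v)_l are linked only
    by the Jacobi identity. Its Borcherds form is triangular in both directions, so a subspace
    containing all expressions of one kind contains all those of the other; this replaces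
    associativity throughout. The second obstacle is the twist. The identity holds on each
    g-eigencomponent separately, but h in G need not commute with g, so the components of h a are in
    general not the images under h of the components of a. What is known about h(a_k c) thus
    concerns only the sum over all eigencomponents of h a. The separate products are recovered from
    this sum because the powers (1 + x)^(r/T), r < T, are independent over Laurent polynomials; this
    is the purpose of the binomial series. The grading causes two corrections: the averaged map need
    not preserve degrees, so its degree-preserving part is taken, and modules over V^G may only
    admit a coarser grading than that of M, so degrees are rounded before rationality is applied. *)

Lemma qbinom0 (a : rat) : qbinom a 0 = 1.
Proof. by rewrite /qbinom big_ord0 fact0 divr1. Qed.

Lemma qbinomS (a : rat) k : k.+1%:R * qbinom a k.+1 = (a - k%:R) * qbinom a k.
Proof.
rewrite /qbinom big_ord_recr /= factS natrM.
have k1 : (k.+1%:R : rat) != 0 by rewrite pnatr_eq0.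
have kf : (k`!%:R : rat) != 0 by rewrite pnatr_eq0 -lt0n fact_gt0.
by field; rewrite kf nat1r k1.
Qed.

Lemma qbinom_nat_small (n k : nat) : (n < k)%N -> qbinom n%:R k = 0.
Proof.
move=> nk; rewrite /qbinom (bigD1 (Ordinal nk)) //= subrr mul0r.
by rewrite mul0r.
Qed.

Lemma qbinom_diag (n : nat) : qbinom n%:R n = 1.
Proof.
suff H m k : qbinom (m + k)%:R k = 'C(m + k, k)%:R :> rat.
  by have := H 0%N n; rewrite add0n binn.
apply: (mulIf (_ : (k`!%:R : rat) != 0)); first by rewrite pnatr_eq0 -lt0n fact_gt0.
rewrite /qbinom divfK; last by rewrite pnatr_eq0 -lt0n fact_gt0.
rewrite -natrM bin_ffact ffact_prod natr_prod; apply: eq_bigr => i _.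
by rewrite natrB // (leq_trans (ltnW (ltn_ord i))) // leq_addl.
Qed.

(** Upper negation, by reversing the product. It turns the coefficients of the delta function on the
    iterate side of the Jacobi identity, where the exponent is k - s - 1, into the binomials of s in
    the Borcherds form. *)
Lemma qbinom_neg (s : rat) k :
  (-1) ^+ k * qbinom (k%:R - s - 1) k = qbinom s k.
Proof.
rewrite /qbinom mulrA; congr (_ / _).
rewrite -[X in (-1) ^+ X]card_ord -prodrN.
rewrite (reindex_inj rev_ord_inj) /=; apply: eq_bigr => i _.
by rewrite natrB // -natr1; ring.
Qed.

(** The coefficient of x^k in (1 + x)^a (1 + x)^b for rational exponents. In the induction, k + 1 is
    split as i + (k + 1 - i); [qbinomS] applied to each half leaves the common factor (a - i) + (b -
    (k - i)) = a + b - k. *)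
Lemma qbinom_vandermonde (a b : rat) k :
  \sum_(i < k.+1) qbinom a i * qbinom b (k - i) = qbinom (a + b) k.
Proof.
elim: k => [|k IH]; first by rewrite big_ord_recl big_ord0 !qbinom0 addr0 mulr1.
have k1 : (k.+1%:R : rat) != 0 by rewrite pnatr_eq0.
apply: (mulfI k1); rewrite qbinomS -IH.
rewrite mulr_sumr.
have -> : \sum_(i < k.+2) k.+1%:R * (qbinom a i * qbinom b (k.+1 - i)) =
    \sum_(i < k.+2) (i%:R * qbinom a i) * qbinom b (k.+1 - i) +
    \sum_(i < k.+2) qbinom a i * ((k.+1 - i)%:R * qbinom b (k.+1 - i)).
  rewrite -big_split /=; apply: eq_bigr => i _.
  have ik : (i <= k.+1)%N by rewrite -ltnS.
  by rewrite natrB //; ring.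
rewrite big_ord_recl /= !mul0r add0r.
rewrite [X in _ + X]big_ord_recr /= subnn mul0r mulr0 addr0.
rewrite mulr_sumr -big_split /=; apply: eq_bigr => i _.
rewrite /bump /= add1n subSS qbinomS.
have ik : (i <= k)%N by rewrite -ltnS.
by rewrite subSn // qbinomS natrB //; ring.
Qed.

End Binomials.

Section BinomialSeries.
Context {C : numFieldType} {X : lmodType C}.

Definition qbin (s : rat) (k : nat) : C := ratr (qbinom s k).

Lemma qbin0 s : qbin s 0 = 1.
Proof. by rewrite /qbin qbinom0 rmorph1. Qed.

(** With y the series variable, the operator (1 + y) d/dy - [al x] multiplies (1 + y)^(al i) by
    [al i - al x]. It kills the head x of the list and rescales the other coefficients by nonzero
    scalars, whence an induction on the list. *)
Lemma qbin_independent (J : eqType) (l : seq J) (al : J -> rat) (c : J -> X) :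
  uniq l -> {in l &, injective al} ->
  (forall k, \sum_(j <- l) qbin (al j) k *: c j = 0) ->
  forall j, j \in l -> c j = 0.
Proof.
elim: l c => [|x l IH] c //= /andP[xl ul] inj H.
have injl : {in l &, injective al}.
  by move=> i j il jl; apply: inj; rewrite inE ?il ?jl orbT.
have Hl j : j \in l -> c j = 0.
  move=> jl.
  have aj : al j != al x.
    apply: contraNneq xl => e.
    by rewrite -(inj j x) // inE ?jl ?orbT ?eqxx.
  have E k : \sum_(i <- l) qbin (al i) k *: ((ratr (al i - al x) : C) *: c i) = 0.
    have Hk := H k; have HSk := H k.+1.
    have : \sum_(i <- x :: l) (ratr (al i - al x) * qbin (al i) k) *: c i = 0.
      have -> : \sum_(i <- x :: l) (ratr (al i - al x) * qbin (al i) k) *: c i =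
        (k.+1%:R : C) *: (\sum_(i <- x :: l) qbin (al i) k.+1 *: c i)
        + (ratr (k%:R - al x) : C) *: (\sum_(i <- x :: l) qbin (al i) k *: c i).
        rewrite !scaler_sumr -big_split /=; apply: eq_bigr => i _.
        rewrite !scalerA -scalerDl; congr (_ *: _).
        have -> : (k.+1%:R : C) = ratr k.+1%:R by rewrite ratr_nat.
        by rewrite /qbin -!rmorphM -rmorphD qbinomS; congr ratr; ring.
      by rewrite Hk HSk !scaler0 addr0.
    rewrite big_cons subrr rmorph0 mul0r scale0r add0r => E0.
    rewrite -[RHS]E0; apply: eq_bigr => i _.
    by rewrite scalerA mulrC.
  have /eqP := IH _ ul injl E j jl.
  by rewrite scaler_eq0 fmorph_eq0 subr_eq0 (negbTE aj) => /eqP.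
move=> j; rewrite inE => /orP[/eqP->|]; last exact: Hl.
have := H 0%N; rewrite big_cons qbin0 scale1r big_seq big1 ?addr0 //.
by move=> i il; rewrite Hl // scaler0.
Qed.

(* If (1 + x)^s F(x) is a polynomial of degree < n, then F is a combination of
   the series (1 + x)^(i - s), i < n. *)
Lemma qbin_series_polynomial (s : rat) (n : nat) (F : nat -> X) :
  (forall j, (n <= j)%N -> \sum_(i < j.+1) qbin s i *: F (j - i)%N = 0) ->
  exists c : nat -> X, forall k, F k = \sum_(i < n) qbin (i%:R - s) k *: c i.
Proof.
elim: n F => [|n IH] F H.
  exists (fun=> 0) => k; rewrite big_ord0.
  have [m] := ubnP k; elim: m k => // m IHm k km.
  have := H k isT; rewrite big_ord_recl qbin0 scale1r subn0 big1 ?addr0 //.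
  move=> i _; rewrite IHm ?scaler0 //= /bump /= add1n.
  have := ltn_ord i; lia.
(* [g] is the coefficient of degree n in (1 + x)^s F. Since (1 + x)^s (1 + x)^(n - s) = (1 + x)^n
   has leading coefficient 1, subtracting g (1 + x)^(n - s) from F lowers the degree bound. *)
pose g := \sum_(i < n.+1) qbin s i *: F (n - i)%N.
have [c Hc] : exists c : nat -> X, forall k,
    F k - qbin (n%:R - s) k *: g = \sum_(i < n) qbin (i%:R - s) k *: c i.
  apply: IH => j nj.
  under eq_bigr do rewrite scalerBr.
  rewrite sumrB.
  have -> : \sum_(i < j.+1) qbin s i *: (qbin (n%:R - s) (j - i) *: g) =
            qbin n%:R j *: g.
    under eq_bigr do rewrite scalerA.
    rewrite -scaler_suml; congr (_ *: _).
    rewrite /qbin; under eq_bigr do rewrite -rmorphM.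
    by rewrite -rmorph_sum qbinom_vandermonde; congr (ratr (qbinom _ _)); ring.
  move: nj; rewrite leq_eqVlt => /orP[/eqP <-|nj].
    by rewrite /qbin qbinom_diag rmorph1 scale1r subrr.
  by rewrite H // /qbin qbinom_nat_small // rmorph0 scale0r subrr.
exists (fun i => if i == n then g else c i) => k.
rewrite big_ord_recr /= eqxx; apply/eqP; rewrite -subr_eq Hc; apply/eqP.
by apply: eq_bigr => i _; rewrite ltn_eqF.
Qed.

(** Each F r is a combination of powers (1 + x)^(i - s r). The exponents differ for distinct pairs
    (r, i), because the s r lie in distinct classes mod Z, so [qbin_independent] applies to all
    pairs at once. *)
Lemma qbin_series_independent (I : finType) (s : I -> rat) (F : I -> nat -> X) :
  (forall i j, (s i - s j) \is a Num.int -> i = j) ->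
  (forall r, exists n, forall j, (n <= j)%N ->
     \sum_(i < j.+1) qbin (s r) i *: F r (j - i)%N = 0) ->
  (forall k, \sum_r F r k = 0) -> forall r k, F r k = 0.
Proof.
move=> sinj /choice[n Hn] F0.
pose m := \max_r n r.
have /choice[c Hc] r : exists c : nat -> X, forall k,
    F r k = \sum_(i < m) qbin (i%:R - s r) k *: c i.
  apply: qbin_series_polynomial => j mj; apply: Hn.
  by apply: leq_trans mj; exact: leq_bigmax.
suff z (p : I * 'I_m) : c p.1 p.2 = 0.
  by move=> r k; rewrite Hc big1 // => i _; rewrite (z (r, i)) scaler0.
apply: (@qbin_independent _ (index_enum _)
   (fun p : I * 'I_m => p.2%:R - s p.1) (fun p => c p.1 p.2)).
- by rewrite /index_enum -enumT enum_uniq.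
- move=> [i j] [i' j'] _ _ /= e.
  have ii : i = i'.
    apply: sinj; have -> : s i - s i' = j%:R - j'%:R by lra.
    by rewrite rpredB ?natr_int.
  rewrite -ii in e *; congr (_, _); apply: ord_inj; apply/eqP.
  by rewrite -(eqr_nat rat); apply/eqP; lra.
- move=> k; rewrite -[RHS](F0 k).
  under [RHS]eq_bigr do rewrite Hc.
  by rewrite pair_bigA.
- by rewrite /index_enum -enumT mem_enum.
Qed.

End BinomialSeries.

(** * Borcherds identity *)

Section Subspaces.
Context {C : fieldType} {X : lmodType C}.
Implicit Type S : set X.

Lemma subspace_sum S (I : Type) (r : seq I) (P : pred I) (F : I -> X) :
  subspace S -> (forall i, P i -> S (F i)) -> S (\sum_(i <- r | P i) F i).
Proof.
move=> sS SF; apply: big_ind => //; first by case: sS.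
by move=> x y; apply: subspaceD.
Qed.

Lemma subspaceN S x : subspace S -> S x -> S (- x).
Proof. by move=> sS Sx; rewrite -scaleN1r; apply: subspaceZ. Qed.

Lemma subspaceB S x y : subspace S -> S x -> S y -> S (x - y).
Proof. by move=> sS Sx Sy; apply: subspaceD => //; apply: subspaceN. Qed.

Lemma subspace_set0 : subspace [set 0 : X].
Proof. by split=> // a u v /= -> ->; rewrite scaler0 addr0. Qed.

Lemma subspaceI S S' : subspace S -> subspace S' -> subspace (S `&` S').
Proof.
move=> [S0 SD] [S'0 S'D]; split=> // a u v [Su S'u] [Sv S'v].
by split; [apply: SD|apply: S'D].
Qed.

End Subspaces.

Section LinearMaps.
Context {R : realType}.
Local Notation C := R[i].
Implicit Types X Y Z : lmodType C.

Lemma linear_comp X Y Z (f : Y -> Z) (h : X -> Y) :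
  linear f -> linear h -> linear (fun x => f (h x)).
Proof. by move=> lf lh a x y; rewrite lh lf. Qed.

Lemma linear_bigsum X Y (I : finType) (F : I -> X -> Y) :
  (forall i, linear (F i)) -> linear (fun x => \sum_i F i x).
Proof.
move=> lF a x y; rewrite scaler_sumr -big_split.
by apply: eq_bigr => i _; rewrite lF.
Qed.

Lemma linear_sub X Y (f h : X -> Y) :
  linear f -> linear h -> linear (fun x => f x - h x).
Proof. by move=> lf lh a x y; rewrite lf lh scalerBr opprD addrACA. Qed.

Lemma subspace_preimage X Y (f : X -> Y) (S : set Y) :
  linear f -> subspace S -> subspace [set x | S (f x)].
Proof.
move=> lf [S0 SD]; split=> [|a x y] /=; first by rewrite (lin0 lf).
by rewrite lf; apply: SD.
Qed.

End LinearMaps.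

Lemma rat_le_nat (x : rat) : exists n : nat, x <= n%:R.
Proof.
have [x0|x0] := leP 0 x; last by exists 0%N; apply: ltW.
by exists (Num.bound x); apply: ltW; apply: archi_boundP.
Qed.

(** The bound is a successor so that the term k = 0 can be split off the truncated sums below. *)
Lemma rat_le_nat3 (x y z : rat) :
  exists n : nat, [/\ x <= n.+1%:R, y <= n.+1%:R & z <= n.+1%:R].
Proof.
have [n] := rat_le_nat (Num.max x (Num.max y z)).
rewrite !ge_max => /and3P[a b c].
by exists n; split; apply: le_trans (_ : n%:R <= _); rewrite ?ler_nat.
Qed.

Lemma coset_ge (al x : rat) : exists2 s, in_coset al s & x <= s.
Proof.
have [n xn] := rat_le_nat (x - al); exists (al + n%:R); last by lra.
by rewrite /in_coset addrC addKr natr_int.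
Qed.

Section BorcherdsTriples.
Context {R : realType}.
Local Notation C := R[i].
Implicit Type X : lmodType C.

(* For D m n = u_m v_n w, D' n m = v_n u_m w and E k l = (u_k v)_l w this is the
   Borcherds form of the Jacobi identity, with al = r / T and e = (-1)^(ij). *)
Definition borcherds X (al : rat) (e : C) (D D' E : rat -> rat -> X) : Prop :=
  exists N : rat,
  [/\ forall m n, N <= n -> D m n = 0,
      forall n m, N <= m -> D' n m = 0,
      forall k l, N <= k -> E k l = 0
    & forall (l : int) (s t : rat) (K : nat), in_coset al s ->
        N <= t + K%:R -> N <= s + K%:R -> N <= l%:~R + K%:R ->
      \sum_(k < K) ((-1) ^+ k * qbin l%:~R k : C) *:
          D (s + l%:~R - k%:R) (t + k%:R)
      - (e * (-1) ^ l) *: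
        (\sum_(k < K) ((-1) ^+ k * qbin l%:~R k : C) *:
          D' (t + l%:~R - k%:R) (s + k%:R))
      = \sum_(k < K) qbin s k *: E (l%:~R + k%:R) (s + t - k%:R)].

Lemma borcherds0 X al e : borcherds al e (fun _ _ => 0 : X) (fun _ _ => 0) (fun _ _ => 0).
Proof.
exists 0; split=> // l s t K _ _ _ _.
by rewrite !big1 ?scaler0 ?subrr // => i _; rewrite scaler0.
Qed.

Lemma borcherdsD X al e (D1 D1' E1 D2 D2' E2 : rat -> rat -> X) :
  borcherds al e D1 D1' E1 -> borcherds al e D2 D2' E2 ->
  borcherds al e (fun m n => D1 m n + D2 m n) (fun m n => D1' m n + D2' m n)
    (fun m n => E1 m n + E2 m n).
Proof.
move=> [N1 [a1 b1 c1 d1]] [N2 [a2 b2 c2 d2]].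
exists (Num.max N1 N2); split.
- by move=> m n; rewrite ge_max => /andP[h1 h2]; rewrite a1 // a2 // addr0.
- by move=> m n; rewrite ge_max => /andP[h1 h2]; rewrite b1 // b2 // addr0.
- by move=> m n; rewrite ge_max => /andP[h1 h2]; rewrite c1 // c2 // addr0.
move=> l s t K sal; rewrite !ge_max => /andP[t1 t2] /andP[s1 s2] /andP[l1 l2].
have E1E := d1 l s t K sal t1 s1 l1; have E2E := d2 l s t K sal t2 s2 l2.
have sumZD (n : nat) (c : 'I_n -> C) (f g : 'I_n -> X) :
    \sum_i c i *: (f i + g i) = \sum_i c i *: f i + \sum_i c i *: g i.
  by rewrite -big_split; apply: eq_bigr => i _; rewrite scalerDr.
by rewrite !sumZD -E1E -E2E scalerDr opprD addrACA.
Qed.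

(** The identity only compares linear combinations of values, so it passes through any linear map.
    This matters for the projection [p] below, which is known to commute only with the modes of
    V^G. *)
Lemma borcherds_lin X X' (f : X -> X') al e (D D' E : rat -> rat -> X) :
  linear f -> borcherds al e D D' E ->
  borcherds al e (fun m n => f (D m n)) (fun m n => f (D' m n))
    (fun m n => f (E m n)).
Proof.
move=> lf [N [a b c d]].
have f0 := lin0 lf.
have fS (I : Type) (r : seq I) (g : I -> C) (h : I -> X) :
    \sum_(i <- r) g i *: f (h i) = f (\sum_(i <- r) g i *: h i).
  by rewrite (lin_sum lf); apply: eq_bigr => i _; rewrite (linZ lf).
exists N; split.
- by move=> m n h; rewrite a.
- by move=> m n h; rewrite b.
- by move=> m n h; rewrite c.
move=> l s t K *; rewrite !fS -d //.
by rewrite -(linZ lf) -(linB lf).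
Qed.

Lemma borcherdsB X al (e : C) (D1 D1' E1 D2 D2' E2 : rat -> rat -> X) :
  borcherds al e D1 D1' E1 -> borcherds al e D2 D2' E2 ->
  borcherds al e (fun m n => D1 m n - D2 m n) (fun m n => D1' m n - D2' m n)
    (fun m n => E1 m n - E2 m n).
Proof.
move=> B1 B2; apply: borcherdsD B1 _; apply: borcherds_lin B2.
by move=> a x y; rewrite opprD scalerN.
Qed.

Lemma borcherds_sum X al e (I : finType) (D D' E : I -> rat -> rat -> X) :
  (forall i, borcherds al e (D i) (D' i) (E i)) ->
  borcherds al e (fun m n => \sum_i D i m n) (fun m n => \sum_i D' i m n)
    (fun m n => \sum_i E i m n).
Proof.
move=> H.
suff H' (r : seq I) : borcherds al e (fun m n => \sum_(i <- r) D i m n)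
    (fun m n => \sum_(i <- r) D' i m n) (fun m n => \sum_(i <- r) E i m n).
  exact: H'.
elim: r => [|x r IH].
  have -> : (fun m n => \sum_(i <- [::]) D i m n) = fun _ _ => 0.
    by do 2!apply: funext => ?; rewrite big_nil.
  have -> : (fun m n => \sum_(i <- [::]) D' i m n) = fun _ _ => 0.
    by do 2!apply: funext => ?; rewrite big_nil.
  have -> : (fun m n => \sum_(i <- [::]) E i m n) = fun _ _ => 0.
    by do 2!apply: funext => ?; rewrite big_nil.
  exact: borcherds0.
have -> : (fun m n => \sum_(i <- x :: r) D i m n) =
    fun m n => D x m n + \sum_(i <- r) D i m n.
  by do 2!apply: funext => ?; rewrite big_cons.
have -> : (fun m n => \sum_(i <- x :: r) D' i m n) =
    fun m n => D' x m n + \sum_(i <- r) D' i m n.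
  by do 2!apply: funext => ?; rewrite big_cons.
have -> : (fun m n => \sum_(i <- x :: r) E i m n) =
    fun m n => E x m n + \sum_(i <- r) E i m n.
  by do 2!apply: funext => ?; rewrite big_cons.
exact: borcherdsD.
Qed.

Section Triangular.
Context {X : lmodType C} (al : rat) (e : C) (D D' E : rat -> rat -> X).
Hypothesis B : borcherds al e D D' E.
Context (S : set X) (sS : subspace S).

(** Choosing s >= N in the coset removes the D' terms. What remains expresses E k l by products and
    by terms E (k + i) with i > 0, so descending induction on k works, starting where E vanishes. *)
Lemma borcherds_iterate :
  (forall m n, in_coset al m -> S (D m n)) -> forall (k : int) l, S (E k%:~R l).
Proof.
case: B => N [aN bN cN dN] SD k l.
have [j Nj] := rat_le_nat (N - k%:~R).
elim: j k l Nj => [|j IH] k l Nj.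
  by rewrite cN; [exact: (proj1 sS)|move: Nj; rewrite mulr0n; lra].
have [s sal Ns] := coset_ge al N.
have [K [K1 K2 _]] := rat_le_nat3 (N - (l - s)) (N - k%:~R) 0.
have K0 : (0 : rat) <= K.+1%:R by [].
have := dN k s (l - s) K.+1 sal ltac:(lra) ltac:(lra) ltac:(lra).
rewrite [in RHS]big_ord_recl qbin0 scale1r => /eqP.
rewrite -subr_eq mulr0n !(addr0, subr0) => /eqP.
rewrite [X in E _ X]addrC subrK => <-.
apply: subspaceB => //; first apply: subspaceB => //.
- apply: subspace_sum => // i _; apply: subspaceZ => //; apply: SD.
  rewrite /in_coset.
  have -> : s + k%:~R - i%:R - al = (s - al) + (k%:~R - i%:R) by ring.
  by rewrite rpredD // rpredB // ?natr_int // intr_int.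
- apply: subspaceZ => //; apply: subspace_sum => // i _.
  apply: subspaceZ => //; rewrite bN; first exact: (proj1 sS).
  by apply: le_trans Ns _; rewrite lerDl.
- apply: subspace_sum => // i _; apply: subspaceZ => //.
  have -> : k%:~R + (bump 0 i)%:R = (k + (i.+1)%:Z)%:~R :> rat.
    by rewrite intrD /bump add1n.
  apply: IH; rewrite intrD -pmulrn -natr1.
  by move: Nj; rewrite -natr1; have : (0 : rat) <= i%:R by []; lra.
Qed.

(** The same choice of s, with the identity solved for its term k = 0 on the left: D m n is a
    combination of iterates and of products D (m - i) (n + i) with i > 0. The induction descends on
    n. *)
Lemma borcherds_product :
  (forall (k : int) l, S (E k%:~R l)) -> forall m n, in_coset al m -> S (D m n).
Proof.
case: B => N [aN bN cN dN] SE m n.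
have [j Nj] := rat_le_nat (N - n).
elim: j m n Nj => [|j IH] m n Nj mal.
  by rewrite aN; [exact: (proj1 sS)|move: Nj; rewrite mulr0n; lra].
have [s sal Ns] := coset_ge al N.
have /intrP[l lE] : m - s \is a Num.int.
  have -> : m - s = (m - al) - (s - al) by ring.
  by rewrite rpredB.
have {lE} mE : m = s + l%:~R by rewrite -lE addrC subrK.
rewrite {m}mE in mal *.
have [K [K1 K2 _]] := rat_le_nat3 (N - n) (N - l%:~R) 0.
have K0 : (0 : rat) <= K.+1%:R by [].
have := dN l s n K.+1 sal ltac:(lra) ltac:(lra) ltac:(lra).
rewrite [X in X - _]big_ord_recl expr0 qbin0 mulr1 scale1r => /eqP.
rewrite subr_eq -subr_eq0 => /eqP h.
have -> : D (s + l%:~R) n = - (\sum_(i < K) ((-1) ^+ (bump 0 i) * qbin l%:~R (bump 0 i) : C) *: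
     D (s + l%:~R - (bump 0 i)%:R) (n + (bump 0 i)%:R)) +
   (\sum_(k < K.+1) qbin s k *: E (l%:~R + k%:R) (s + n - k%:R)
   + (e * (-1) ^ l) *: (\sum_(k < K.+1) ((-1) ^+ k * qbin l%:~R k : C) *:
      D' (n + l%:~R - k%:R) (s + k%:R))).
  apply/eqP; rewrite -subr_eq0 opprD opprK addrA; apply/eqP.
  by rewrite -[RHS]h mulr0n !(addr0, subr0).
apply: subspaceD => //; last apply: subspaceD => //.
- apply: subspaceN => //; apply: subspace_sum => // i _; apply: subspaceZ => //.
  apply: IH.
    move: Nj; rewrite /bump add1n -!natr1.
    by have : (0 : rat) <= i%:R by []; lra.
  rewrite /in_coset addrAC rpredB ?natr_int //.
- apply: subspace_sum => // i _; apply: subspaceZ => //.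
  have -> : l%:~R + i%:R = (l + i%:Z)%:~R :> rat by rewrite intrD.
  exact: SE.
- apply: subspaceZ => //; apply: subspace_sum => // i _.
  apply: subspaceZ => //; rewrite bN; first exact: (proj1 sS).
  by apply: le_trans Ns _; rewrite lerDl.
Qed.

(** The case l = 0: only the term k = 0 survives in each sum of products, which leaves the
    commutator formula. *)
Lemma borcherds_commutator : e != 0 ->
  (forall m n, in_coset al m -> S (D m n)) ->
  (forall (k : int) l, S (E k%:~R l)) ->
  forall m n, in_coset al m -> S (D' n m).
Proof.
case: B => N [aN bN cN dN] e0 SD SE m n mal.
have [K [K1 K2 K3]] := rat_le_nat3 (N - n) (N - m) N.
have h := dN 0 m n K.+1 mal ltac:(lra) ltac:(lra) ltac:(rewrite add0r; lra).
have D'E : \sum_(k < K.+1) ((-1) ^+ k * qbin 0%:~R k : C) *: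
    D' (n + 0%:~R - k%:R) (m + k%:R) = D' n m.
  rewrite big_ord_recl big1 => [|i _]; last first.
    by rewrite /qbin (qbinom_nat_small (n := 0)) // rmorph0 mulr0 scale0r.
  by rewrite expr0 qbin0 mulr1 scale1r !(addr0, subr0).
rewrite D'E expr0z mulr1 in h.
have -> : D' n m = e^-1 *: (\sum_(k < K.+1) ((-1) ^+ k * qbin 0%:~R k : C) *:
    D (m + 0%:~R - k%:R) (n + k%:R)
   - \sum_(k < K.+1) qbin m k *: E (0%:~R + k%:R) (m + n - k%:R)).
  by rewrite -h opprB addrC subrK scalerA mulVf // scale1r.
apply: subspaceZ => //; apply: subspaceB => //.
  apply: subspace_sum => // i _; apply: subspaceZ => //; apply: SD.
  rewrite /in_coset addr0.
  by rewrite addrAC rpredB ?natr_int.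
apply: subspace_sum => // i _; apply: subspaceZ => //.
by rewrite add0r pmulrn.
Qed.

End Triangular.

(* Twisted modes satisfy the Jacobi identity only on each eigencomponent u^r of
   u, with the factor (1 + x)^(r/T) depending on r; the sum over r of the
   (u^r_k v)_l still determines the products u_m v_n, because the functions
   (1 + x)^s with s distinct mod Z are independent over Laurent polynomials. *)
Lemma borcherds_separate X (I : finType) (al : I -> rat) (e : C)
    (D D' E : I -> rat -> rat -> X) :
  (forall i j, (al i - al j) \is a Num.int -> i = j) ->
  (forall r, borcherds (al r) e (D r) (D' r) (E r)) ->
  (forall (k : int) l, \sum_r E r k%:~R l = 0) ->
  forall r m n, in_coset (al r) m -> D r m n = 0.
Proof.
move=> alinj B E0 r m n mal.
suff z r' (k : int) l : E r' k%:~R l = 0.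
  apply: (borcherds_product (B r) subspace_set0) => // k l; exact: z.
move: r' k l => {r m n mal}.
have /choice[N HN] := B.
have /choice[s Hs] r : exists s, in_coset (al r) s /\ N r <= s.
  by have [s] := coset_ge (al r) (N r); exists s.
pose M := \max_r Num.bound (`|N r|).
have NM r : N r <= M%:R.
  apply: le_trans (_ : (Num.bound `|N r|)%:R <= _).
    by apply: ltW; apply: le_lt_trans (archi_boundP _); rewrite ?ler_norm.
  by rewrite ler_nat; apply: (@leq_bigmax _ (fun r => Num.bound `|N r|)).
(* M bounds all the N r, so E r vanishes from first index M on. With the sum q of the two indices
   fixed, the values of E r read downwards from M - 1 are the coefficients of a power series. *)
suff z q r (j : nat) : E r (M%:Z - 1 - j%:Z)%:~R (q - (M%:Z - 1 - j%:Z)%:~R) = 0.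
  move=> r k l; have [/ZnatP[j jE]|kM] := boolP ((M%:Z - 1 - k)%R \is a Num.nat).
    have -> : k = M%:Z - 1 - j%:Z by lia.
    by have := z (l + (M%:Z - 1 - j%:Z)%:~R) r j; rewrite addrK.
  have [_ _ cN _] := HN r; apply: cN; apply: le_trans (NM r) _.
  rewrite pmulrn ler_int leNgt; apply: contra kM => kM.
  by rewrite Znat_def; lia.
apply: (@qbin_series_independent C X I s
   (fun r j => E r (M%:Z - 1 - j%:Z)%:~R (q - (M%:Z - 1 - j%:Z)%:~R))).
- move=> i i0 sij; apply: alinj; have [si _] := Hs i; have [sj _] := Hs i0.
  have -> : al i - al i0 = (s i - s i0) - (s i - al i) + (s i0 - al i0) by ring.
  by rewrite rpredD // rpredB.
- move=> {}r; have [sal Ns] := Hs r; have [aN bN cN dN] := HN r.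
  (* For j >= J the index t = q - l - s is at least N, so the products D vanish; the D' vanish
     because s >= N. The terms with i > j on the right vanish because l + i >= M. What remains says
     that (1 + x)^(s r) times the series has no term of degree j. *)
  have [J HJ] := rat_le_nat (N r - q + (M%:Z - 1)%:~R + s r); exists J => {}j Jj.
  have Jj' : (J%:R : rat) <= j%:R by rewrite ler_nat.
  pose l := M%:Z - 1 - j%:Z.
  have lE : (l%:~R : rat) = (M%:Z - 1)%:~R - j%:R by rewrite rmorphB.
  pose t := q - l%:~R - s r.
  have Nt : N r <= t by rewrite /t lE; lra.
  have [K0 HK0] := rat_le_nat (N r - l%:~R).
  pose K := maxn K0 j.+1.
  have K0K : (K0%:R : rat) <= K%:R by rewrite ler_nat leq_maxl.
  have ge0 (i : nat) : (0 : rat) <= i%:R by [].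
  have gK := ge0 K.
  have := dN l (s r) t K sal ltac:(lra) ltac:(lra) ltac:(lra).
  rewrite [X in X - _]big1 => [|i _]; last first.
    by rewrite aN ?scaler0 //; have := ge0 i; lra.
  rewrite [X in _ *: X]big1 => [|i _]; last first.
    by rewrite bN ?scaler0 //; have := ge0 i; lra.
  rewrite scaler0 subr0 => h.
  rewrite [RHS]h (big_ord_widen K (fun i => qbin (s r) i *:
    E r (M%:Z - 1 - (j - i)%N%:Z)%:~R (q - (M%:Z - 1 - (j - i)%N%:Z)%:~R)));
    last by rewrite leq_maxr.
  rewrite big_mkcond; apply: eq_bigr => i _.
  case: ifPn => ij.
    have iE : (M%:Z - 1 - (j - i)%N%:Z)%:~R = l%:~R + i%:R :> rat.
      by rewrite /l -[i%:R]/(i%:Z%:~R) -intrD; congr (_%:~R); lia.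
    by rewrite iE /t; congr (_ *: E r _ _); ring.
  rewrite cN ?scaler0 //; apply: le_trans (NM r) _.
  rewrite /l -[i%:R]/(i%:Z%:~R) -intrD pmulrn ler_int; lia.
- by move=> {}j; apply: E0.
Qed.

End BorcherdsTriples.

(** * From delta functions to the Borcherds form *)

Section JacobiToBorcherds.
Context {R : realType}.
Local Notation C := R[i].

(** Extracting a coefficient leaves, for each k, a single exponent n in the sum over Z x N, and
    truncation bounds k. *)
Lemma fsum_graph (X : lmodType C) (f : int * nat -> X) (g : nat -> int) (K : nat) :
  (forall n k, n != g k -> f (n, k) = 0) ->
  (forall k, (K <= k)%N -> f (g k, k) = 0) ->
  \sum_(p \in [set: int * nat]) f p = \sum_(k < K) f (g k, nat_of_ord k).
Proof.
move=> f0 fK.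
rewrite (fsbigE [seq (g k, k) | k <- iota 0 K]).
- rewrite big_map -(big_mkord xpredT (fun k => f (g k, k))) /index_iota subn0.
  by apply: eq_bigl => k; rewrite in_setT.
- by rewrite map_inj_uniq ?iota_uniq // => k k' [].
- by [].
move=> [n k] _ /= nr; have [nE|] := eqVneq n (g k); last exact: f0.
rewrite nE; apply: fK; rewrite leqNgt; apply: contra nr => kK.
by rewrite nE; apply/mapP; exists k; rewrite // mem_iota.
Qed.

(** The coefficient of z0^(-l-1) z1^(-s-1) z2^(-t-1). On the left the power of z0 forces n = l. On
    the right the power of z1 forces n = al - s - 1 + k, an integer exactly because s lies in al +
    Z. *)
Lemma jacobi_borcherds (V M : lmodType C) (Y : V -> rat -> V -> V)
    (YM : V -> rat -> M -> M) (al : rat) (i j : bool) (u v : V) (w : M) :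
  (forall n, linear (fun x => YM x n w)) -> (forall x n, linear (YM x n)) ->
  (exists N, forall n, N <= n -> YM u n w = 0) ->
  (exists N, forall n, N <= n -> YM v n w = 0) ->
  (exists N, forall n, N <= n -> Y u n v = 0) ->
  jacobi Y YM al i j u v ->
  borcherds al ((-1) ^+ (i && j)) (fun m n => YM u m (YM v n w))
    (fun n m => YM v n (YM u m w)) (fun k l => YM (Y u k v) l w).
Proof.
move=> linl linr [N1 H1] [N2 H2] [N3 H3] jac.
pose N := Num.max N1 (Num.max N2 N3).
have {}H1 n : N <= n -> YM u n w = 0.
  by rewrite !ge_max => /and3P[h _ _]; apply: H1.
have {}H2 n : N <= n -> YM v n w = 0.
  by rewrite !ge_max => /and3P[_ h _]; apply: H2.
have {}H3 n : N <= n -> Y u n v = 0.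
  by rewrite !ge_max => /and3P[_ _ h]; apply: H3.
have lin00 x n : YM x n 0 = 0 := lin0 (linr x n).
exists N; split.
- by move=> m n h; rewrite H2 ?lin00.
- by move=> m n h; rewrite H1 ?lin00.
- by move=> m n h; rewrite H3 // (lin0 (linl n)).
move=> l s t K sal tK sK lK.
have := jac w (- l%:~R - 1) (- s - 1) (- t - 1).
have ge K' : (K <= K')%N -> (K%:R : rat) <= K'%:R by rewrite ler_nat.
have intE (n : int) : (- l%:~R - 1 - (- n%:~R - 1) == 0 :> rat) = (n == l).
  rewrite -(inj_eq (intr_inj (R := rat))).
  by apply/eqP/eqP => h; lra.
rewrite /mulK (fsum_graph (g := fun=> l) (K := K)); first last.
- move=> k /ge kK /=; rewrite intE eqxx H2 ?lin00 ?scaler0 //; lra.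
- by move=> n k /negbTE nl /=; rewrite intE nl scaler0.
rewrite (fsum_graph (g := fun=> l) (K := K)); first last.
- move=> k /ge kK /=; rewrite intE eqxx H1 ?lin00 ?scaler0 //; lra.
- by move=> n k /negbTE nl /=; rewrite intE nl scaler0.
have /intrP[n0 n0E] : - s - 1 + al \is a Num.int.
  have -> : - s - 1 + al = - ((s - al) + 1) by ring.
  by rewrite rpredN rpredD.
have bE (n : int) (k : nat) :
    (- s - 1 - (n%:~R - al - k%:R) == 0 :> rat) = (n == n0 + k%:Z).
  rewrite -(inj_eq (intr_inj (R := rat))) intrD -n0E.
  have -> : (k%:Z)%:~R = k%:R :> rat by [].
  by apply/eqP/eqP => h; lra.
rewrite (fsum_graph (g := fun k => n0 + k%:Z) (K := K)); first last.
- move=> k /ge kK /=; rewrite bE eqxx H3 ?(lin0 (linl _)) ?scaler0 //; lra.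
- by move=> n k /negbTE nl /=; rewrite bE nl scaler0.
move=> J; transitivity (\sum_(k < K)
   ratr (mcoef (delta10 al (n0 + k%:Z, nat_of_ord k))) *:
     YM (Y u (l%:~R + k%:R) v) (s + t - k%:R) w); last first.
  apply: eq_bigr => k _; congr (_ *: _); rewrite /qbin; congr ratr.
  rewrite /= intrD -n0E -[RHS]qbinom_neg; congr (_ * qbinom _ _).
  by rewrite -[(k%:Z)%:~R]/(k%:R); ring.
transitivity (\sum_(k < K) ratr (mcoef (delta10 al (n0 + k%:Z, nat_of_ord k))) *:
   (if - s - 1 - mexp1 (delta10 al (n0 + k%:Z, nat_of_ord k)) == 0 then
     YM (Y u (- (- l%:~R - 1 - mexp0 (delta10 al (n0 + k%:Z, nat_of_ord k))) - 1) v)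
       (- (- t - 1 - mexp2 (delta10 al (n0 + k%:Z, nat_of_ord k))) - 1) w else 0)); last first.
  apply: eq_bigr => k _; congr (_ *: _); rewrite /= bE eqxx intrD -n0E.
  congr (YM (Y u _ v) _ w); first by ring.
  by rewrite -[(k%:Z)%:~R]/(k%:R); ring.
rewrite -J; congr (_ - _).
  apply: eq_bigr => k _ /=; rewrite intE eqxx; congr (_ *: YM u _ (YM v _ w)).
  - by rewrite rmorphM rmorphXn rmorphN1.
  - by ring.
  - by ring.
rewrite -scalerA; congr (_ *: _); rewrite scaler_sumr; apply: eq_bigr => k _ /=.
rewrite intE eqxx scalerA; congr (_ *: YM v _ (YM u _ w)).
- rewrite !(rmorphM _ ((-1) ^ _)) !(rmorphM _ (_ ^+ _)) rmorphXn rmorphN1 /=.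
  by rewrite fmorphXz rmorphN1.
- by ring.
- by ring.
Qed.

End JacobiToBorcherds.

(** * Automorphisms of a simple vertex operator superalgebra *)

Section FfunFamilies.
Context {R : realType}.
Local Notation C := R[i].

Lemma ffun_linear (X : lmodType C) (Y : lmodType C) (I : finType) (F : X -> I -> Y) :
  (forall i, linear (F^~ i)) -> linear (fun x => [ffun i => F x i]).
Proof. by move=> lF a x y; apply/ffunP => i; rewrite !ffunE lF. Qed.

Lemma borcherds_ffun (X : lmodType C) (I : finType) (al : rat) (e : C)
    (D D' E : I -> rat -> rat -> X) :
  (forall i, borcherds al e (D i) (D' i) (E i)) ->
  borcherds al e (fun m n => [ffun i => D i m n]) (fun m n => [ffun i => D' i m n])
    (fun m n => [ffun i => E i m n]).
Proof.
move=> H.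
pose single i (x : X) : {ffun I -> X} := [ffun j => if j == i then x else 0].
have lsingle i : linear (single i).
  by move=> a x y; apply/ffunP => j; rewrite !ffunE; case: eqP; rewrite // scaler0 addr0.
have singleE (D0 : I -> rat -> rat -> X) :
    (fun m n => [ffun i => D0 i m n]) = fun m n => \sum_i single i (D0 i m n).
  do 2!apply: funext => ?; apply/ffunP => j; rewrite sum_ffunE ffunE.
  rewrite (bigD1 j) //= ffunE eqxx big1 ?addr0 // => i ij.
  by rewrite ffunE eq_sym (negbTE ij).
rewrite !singleE; apply: borcherds_sum => i; exact: borcherds_lin (H i).
Qed.

End FfunFamilies.

Section Vosa.
Context {R : realType} (V : vosa R).
Local Notation C := R[i].
Local Notation par := (parity (@vgr R V)).

Lemma parity_subspace i : subspace (par i).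
Proof. by split; [exact: parity0|move=> *; exact: parity_lin]. Qed.

Lemma half_int_coset (n : rat) : 2%:R * n \is a Num.int ->
  exists i : bool, in_coset (i%:R / 2%:R) n.
Proof.
move=> /intrP[z zE].
have nE : n = z%:~R / 2%:R by rewrite -zE; field.
have zdiv : z = (z %/ 2)%Z * 2 + (z %% 2)%Z := divz_eq z 2.
have z2 : (z %% 2)%Z = 0 \/ (z %% 2)%Z = 1.
  by have := modz_ge0 z (isT : 2 != 0 :> int); have := ltz_pmod z (isT : (0 : int) < 2); lia.
have qi : ((z %/ 2)%Z%:~R : rat) \is a Num.int by rewrite intr_int.
move: zdiv nE; set q := (z %/ 2)%Z in qi *.
case: z2 => -> -> nE; [exists false|exists true];
  rewrite /in_coset /= (_ : _ - _ = q%:~R) // nE intrD intrM.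
  by rewrite mulr0n mul0r subr0 addr0 mulfK.
by rewrite mulr1n mulrDl addrK mulfK.
Qed.

Lemma coset_parity (n : rat) (v : V) (i : bool) :
  in_coset (i%:R / 2%:R) n -> vgr n v -> par i v.
Proof.
move=> c Vv; exists [:: n], (fun=> v); split=> //; last by rewrite big_seq1.
by move=> j; rewrite inE => /eqP ->.
Qed.

Lemma vgr_parity (n : rat) (v : V) : vgr n v -> exists i, par i v.
Proof.
move=> Vv; have [_ zV] := vgr_grading V.
have [/half_int_coset[j c]|nz] := boolP (2%:R * n \is a Num.int).
  by exists j; exact: coset_parity c Vv.
exists false; rewrite (zV n _ v Vv); first exact: parity0.
exact/negP.
Qed.

Lemma vgr_span (S : set V) : subspace S ->
  (forall n v, vgr n v -> S v) -> forall v, S v.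
Proof.
move=> sS H v; have [[subV dV _] _] := vgr_grading V.
have [s [f [us sf ->]]] : sumspace (@vgr R V) v by rewrite dV.
by rewrite big_seq; apply: subspace_sum => // i /sf; apply: H.
Qed.

(** The Jacobi identity is available only for vectors of definite parity; membership conditions
    linear in a vector are reduced to that case here. *)
Lemma parity_span (S : set V) : subspace S ->
  (forall i v, par i v -> S v) -> forall v, S v.
Proof.
move=> sS H; apply: vgr_span => // n v /vgr_parity[j]; exact: H.
Qed.

Lemma aut_parity (h : aut V) i v : par i v -> par i (h v).
Proof.
move=> [s [f [us sf ->]]]; exists s, (fun j => h (f j)); split=> //.
  by move=> j /sf[c Vj]; split=> //; exact: aut_vgr.
by rewrite (lin_sum (aut_linear h)).
Qed.

Lemma vY_borcherds i j (u v w : V) : par i u -> par j v ->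
  borcherds 0 ((-1) ^+ (i && j)) (fun m n => vY u m (vY v n w))
    (fun n m => vY v n (vY u m w)) (fun k l => vY (vY u k v) l w).
Proof.
move=> pu pv; apply: jacobi_borcherds (vY_jacobi pu pv) => *;
  by [exact: vY_linl|exact: vY_linr|exact: vY_trunc].
Qed.

(** Applying L - x to the sum removes the component of eigenvalue x and multiplies the others by
    nonzero scalars. *)
Lemma eigen_components (S : set V) (L : V -> V) (s : seq rat) (f : rat -> V) :
  subspace S -> linear L -> (forall v, S v -> S (L v)) -> uniq s ->
  (forall i, i \in s -> L (f i) = ratr i *: f i) ->
  S (\sum_(i <- s) f i) -> forall i, i \in s -> S (f i).
Proof.
move=> sS lL SL; elim: s f => [|x s IH] f //= /andP[xs us] Lf Ss.
have Lf' i : i \in s -> L (f i) = ratr i *: f i.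
  by move=> is_; apply: Lf; rewrite inE is_ orbT.
have Sd i : i \in s -> S (f i).
  move=> is_; have ix : i - x != 0.
    by rewrite subr_eq0; apply: contraNneq xs => <-.
  have -> : f i = (ratr (i - x))^-1 *: (ratr (i - x) *: f i).
    by rewrite scalerA mulVf ?scale1r // fmorph_eq0.
  apply: subspaceZ => //.
  apply: (IH (fun i => ratr (i - x) *: f i)) => //.
    by move=> j js; rewrite (linZ lL) Lf' // !scalerA mulrC.
  have := subspaceB sS (SL _ Ss) (subspaceZ (ratr x) sS Ss).
  rewrite (lin_sum lL) scaler_sumr -sumrB big_cons Lf ?inE ?eqxx // subrr add0r.
  rewrite big_seq => H; rewrite big_seq; move: H; congr S.
  by apply: eq_bigr => j js; rewrite Lf' // -scalerBl rmorphB.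
move=> i; rewrite inE => /orP[/eqP ->|]; last exact: Sd.
move: Ss; rewrite big_cons => Ss.
rewrite -(addrK (\sum_(j <- s) f j) (f x)); apply: subspaceB => //.
by rewrite big_seq; apply: subspace_sum.
Qed.

(** In place of skew-symmetry: u is u_(-1) applied to the vacuum, and the commutator formula moves
    x_n past u_(-1), so that only the vectors x_k 1 with x in I have to be controlled. *)
Lemma left_ideal (I : set V) : subspace I ->
  (forall u n v, I v -> I (vY u n v)) -> ideal I.
Proof.
move=> sI HI; split=> // u v n Iv; split; first exact: HI.
have I0 : I 0 by case: sI.
(* x_k 1 is 0 for k >= 0 and x for k = -1. For k < -1 it comes from (L(-1) x)_(k+1) 1 = -(k+1) x_k
   1, where k + 1 is nonzero. *)
have Ivac (k : rat) (x : V) : I x -> I (vY x k (vac V)).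
  have [/intrP[z ->]|nk _] := boolP (k \is a Num.int); last by rewrite vY_int.
  case: z => m; first by rewrite -[_%:~R]/(m%:R) vY_create0.
  elim: m x => [|m IH] x Ix; first by rewrite NegzE mulrNz vY_create.
  have := IH (virasoro (@vY R V) (omega V) (-1) x) (HI _ _ _ Ix).
  rewrite vY_deriv => /(subspaceN sI); rewrite opprK.
  move=> /(subspaceZ ((ratr (Negz m)%:~R)^-1) sI).
  rewrite scalerA mulVf ?fmorph_eq0 ?intr_eq0 // scale1r.
  by congr (I (vY x _ _)); rewrite -[1]/(1%:~R) -rmorphB; congr (_%:~R); lia.
have hom i : vgr i `<=` [set x | I x -> I (vY x n u)].
  move=> x Vx Ix; have [jx px] := vgr_parity Vx.
  move: u; apply: parity_span.
    split=> [|a u1 u2 h1 h2]; first by rewrite (lin0 (vY_linr x n)).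
    by rewrite vY_linr; case: sI => _; apply.
  move=> j u pu; rewrite -[u]vY_create.
  apply: (borcherds_commutator (vY_borcherds (vac V) pu px) sI) => //.
  - by rewrite expf_neq0 // oppr_eq0 oner_eq0.
  - by move=> m l _; apply: HI; apply: Ivac.
  - by move=> k l; apply: Ivac; apply: HI.
have [[subV dV _] _] := vgr_grading V.
have [s [f [us sf vE]]] : sumspace (@vgr R V) v by rewrite dV.
(* L(0) is a mode of omega, so it preserves I, and I contains the homogeneous components of its
   elements. *)
have If i : i \in s -> I (f i).
  apply: (eigen_components sI (L := virasoro (@vY R V) (omega V) 0)) => //.
  - exact: vY_linr.
  - by move=> x; apply: HI.
  - by move=> k /sf; apply: vY_L0.
  - by rewrite -vE.
rewrite vE (lin_sum (vY_linl n u)) big_seq; apply: subspace_sum => // i is_.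
by apply: hom (If i is_); apply: sf.
Qed.

Lemma simple_left_ideal (I : set V) : simple_vosa V -> subspace I ->
  (forall u n v, I v -> I (vY u n v)) -> I = [set 0] \/ I = setT.
Proof. by move=> sV sI HI; apply: sV; apply: left_ideal. Qed.

End Vosa.

(** * Independence of distinct automorphisms of a simple V *)

Section GaloisDensity.
Context {R : realType} (V : vosa R) (sV : simple_vosa V).
Context (gT : finType) (rho : gT -> aut V).
Hypothesis rho_inj : forall x y, rho x =1 rho y -> x = y.
Local Notation C := R[i].

(** The generators play the role of the images of u (x) v under A (x) A -> prod_h A, u (x) v |-> (u
    h(v))_h, for an algebra A with group action. The span is the intersection of the subspaces
    containing them. *)
Let orbit_span (f : {ffun gT -> V}) : Prop :=
  forall S : set {ffun gT -> V}, subspace S ->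
    (forall u n v, S [ffun h => vY u n (rho h v)]) -> S f.

Let spanS : subspace (orbit_span : set _).
Proof.
split=> [S sS _|a f g Sf Sg S sS H]; first by case: sS.
by case: (sS) => _; apply; [apply: Sf|apply: Sg].
Qed.

Let span_gen u n v : orbit_span [ffun h => vY u n (rho h v)].
Proof. by move=> S _; apply. Qed.

Let span0 : orbit_span 0.
Proof. by case: spanS. Qed.

Let span_diag a m f : orbit_span f -> orbit_span [ffun h => vY a m (f h)].
Proof.
move=> /(_ [set f | orbit_span [ffun h => vY a m (f h)]]); apply.
  apply: (subspace_preimage (f := fun f : {ffun gT -> V} =>
    [ffun h => vY a m (f h)]) _ spanS).
  by apply: ffun_linear => h c x y; rewrite !ffunE vY_linr.
move=> u n v /=.
rewrite (_ : [ffun _ => _] = [ffun h => vY a m (vY u n (rho h v))]); last first.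
  by apply/ffunP => h; rewrite !ffunE.
have [mi|nm] := boolP (m \is a Num.int); last first.
  by rewrite (_ : [ffun _ => _] = 0) //; apply/ffunP => h; rewrite !ffunE vY_int.
move: a; apply: parity_span.
  apply: (subspace_preimage (f := fun a =>
    [ffun h => vY a m (vY u n (rho h v))]) _ spanS).
  by apply: ffun_linear => h; exact: vY_linl.
move=> i a pa /=; move: u; apply: parity_span.
  apply: (subspace_preimage (f := fun u =>
    [ffun h => vY a m (vY u n (rho h v))]) _ spanS).
  by apply: ffun_linear => h; apply: (linear_comp (vY_linr _ _)); exact: vY_linl.
move=> j u pu /=.
apply: (borcherds_product (borcherds_ffun
  (fun h => vY_borcherds (rho h v) pa pu)) spanS).
  by move=> k l; apply: span_gen.
by rewrite /in_coset subr0.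
Qed.

(** The commutator formula exchanges the two modes: u_p (h a)_q (h v) = u_p h(a_q v) is a generator,
    and the iterates (u_k (h a))_l (h v) follow from such products. *)
Let span_twist a m f : orbit_span f ->
  orbit_span [ffun h => vY (rho h a) m (f h)].
Proof.
move=> /(_ [set f | orbit_span [ffun h => vY (rho h a) m (f h)]]); apply.
  apply: (subspace_preimage (f := fun f : {ffun gT -> V} =>
    [ffun h => vY (rho h a) m (f h)]) _ spanS).
  by apply: ffun_linear => h c x y; rewrite !ffunE vY_linr.
move=> u n v /=.
rewrite (_ : [ffun _ => _] = [ffun h => vY (rho h a) m (vY u n (rho h v))]); last first.
  by apply/ffunP => h; rewrite !ffunE.
have [ni|nn] := boolP (n \is a Num.int); last first.
  rewrite (_ : [ffun _ => _] = 0) //; apply/ffunP => h.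
  by rewrite !ffunE [vY u n _]vY_int // (lin0 (vY_linr _ m)).
move: a; apply: parity_span.
  apply: (subspace_preimage (f := fun a =>
    [ffun h => vY (rho h a) m (vY u n (rho h v))]) _ spanS).
  by apply: ffun_linear => h; apply: (linear_comp (vY_linl _ _)); exact: aut_linear.
move=> i a pa /=; move: u; apply: parity_span.
  apply: (subspace_preimage (f := fun u =>
    [ffun h => vY (rho h a) m (vY u n (rho h v))]) _ spanS).
  by apply: ffun_linear => h; apply: (linear_comp (vY_linr _ _)); exact: vY_linl.
move=> j u pu /=.
have B := borcherds_ffun (fun h => vY_borcherds (rho h v) pu (aut_parity (rho h) pa)).
have SD p q : orbit_span [ffun h => vY u p (vY (rho h a) q (rho h v))].
  rewrite (_ : [ffun _ => _] = [ffun h => vY u p (rho h (vY a q v))]) //.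
  by apply/ffunP => h; rewrite !ffunE aut_Y.
apply: (borcherds_commutator B spanS).
- by rewrite expf_neq0 // oppr_eq0 oner_eq0.
- by move=> p q _; apply: SD.
- by move=> k l; apply: (borcherds_iterate B spanS).
by rewrite /in_coset subr0.
Qed.

(** The values at h0 of the families in the span vanishing on l form a left ideal, hence 0 or V. The
    value 0 is excluded as in Artin's argument: the value at h0 would then be determined by the
    values on l. *)
Let span_prescribe (l : seq gT) (f : {ffun gT -> V}) : uniq l ->
  exists2 f', orbit_span f' & forall h, h \in l -> f' h = f h.
Proof.
elim: l f => [|h0 l IH] f /=; first by exists 0.
move=> /andP[h0l ul].
pose I x := exists f', [/\ orbit_span f', f' h0 = x & forall h, h \in l -> f' h = 0].
have sI : subspace (I : set V).
  split=> [|c x y [fx [Sx <- x0]] [fy [Sy <- y0]]].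
    by exists 0; split=> // *; rewrite ffunE.
  exists (c *: fx + fy); split; first by case: spanS => _; apply.
    by rewrite !ffunE.
  by move=> h hl; rewrite !ffunE x0 ?y0 // scaler0 addr0.
suff IT : I = setT.
  have [f' Sf' f'E] := IH f ul.
  have [g [Sg gE g0]] : I (f h0 - f' h0) by rewrite IT.
  exists (f' + g); first exact: subspaceD spanS _ _.
  move=> h; rewrite inE ffunE => /orP[/eqP ->|hl]; first by rewrite gE addrC subrK.
  by rewrite f'E // g0 // addr0.
have [|I0|//] := simple_left_ideal sV sI.
  move=> u n x [fx [Sx <- x0]]; exists [ffun h => vY u n (fx h)]; split.
  - exact: span_diag.
  - by rewrite ffunE.
  - by move=> h hl; rewrite ffunE x0 // (lin0 (vY_linr u n)).
pose J h1 x := exists f', [/\ orbit_span f', f' h0 = x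
   & forall h, h \in l -> h != h1 -> f' h = 0].
have sJ h1 : subspace (J h1 : set V).
  split=> [|c x y [fx [Sx <- x0]] [fy [Sy <- y0]]].
    by exists 0; split=> // *; rewrite ffunE.
  exists (c *: fx + fy); split; first by case: spanS => _; apply.
    by rewrite !ffunE.
  by move=> h hl hh; rewrite !ffunE x0 ?y0 // scaler0 addr0.
have J0 h1 : h1 \in l -> J h1 = [set 0].
  move=> h1l; have [|//|JT] := simple_left_ideal sV (sJ h1).
    move=> u n x [fx [Sx <- x0]]; exists [ffun h => vY u n (fx h)]; split.
    - exact: span_diag.
    - by rewrite ffunE.
    - by move=> h hl hh; rewrite ffunE x0 // (lin0 (vY_linr u n)).
  have [fv [Sfv fvE fv0]] : J h1 (vac V) by rewrite JT.
  suff h01 : h0 = h1 by rewrite h01 h1l in h0l.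
  apply: rho_inj => a; apply/eqP; rewrite -subr_eq0; apply/eqP.
  suff : I (rho h0 a - rho h1 a) by rewrite I0.
  (* The difference also vanishes at h1, hence on all of l, and its value at h0 is h0(a) - h1(a). As
     [I] is 0, this forces h0 = h1. *)
  exists ([ffun h => vY (rho h a) (-1) (fv h)]
          - [ffun h => vY (rho h1 a) (-1) (fv h)]); split.
  - by apply: subspaceB spanS _ _; [exact: span_twist|exact: span_diag].
  - by rewrite !ffunE fvE !vY_create.
  - move=> h hl; rewrite !ffunE; have [->|hh] := eqVneq h h1; first by rewrite subrr.
    by rewrite fv0 // !(lin0 (vY_linr _ _)) subrr.
(* From f0 one subtracts, for each h1 in l, a family equal to f0 at h1 and 0 on the rest of l. The
   difference vanishes on l, so its value at h0 lies in [I] = 0; each subtracted family has its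
   value at h0 in [J h1] = 0. *)
have z f0 : orbit_span f0 -> f0 h0 = 0.
  move=> Sf0.
  have /choice[g Hg] h1 : exists g : {ffun gT -> V}, orbit_span g /\
      forall h, h \in l -> g h = if h == h1 then f0 h else 0.
    have [g Sg gE] := IH [ffun h => if h == h1 then f0 h else 0] ul.
    by exists g; split=> // h hl; rewrite gE // ffunE.
  have gz h1 : h1 \in l -> g h1 h0 = 0.
    move=> h1l; suff : J h1 (g h1 h0) by rewrite J0.
    exists (g h1); have [Sg gE] := Hg h1; split=> // h hl hh.
    by rewrite gE // (negbTE hh).
  suff : I (f0 h0 - \sum_(h1 <- l) g h1 h0).
    by rewrite I0 /= big_seq big1 ?subr0 // => h1 /gz.
  exists (f0 - \sum_(h1 <- l) g h1); split.
  - apply: subspaceB spanS _ _ => //; apply: subspace_sum => // h1 _.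
    by case: (Hg h1).
  - by rewrite !ffunE sum_ffunE.
  - move=> h hl; rewrite !ffunE sum_ffunE.
    rewrite (bigD1_seq h) //= big1 ?addr0 => [|h1 hh].
      by have [_ ->] := Hg h; rewrite // eqxx subrr.
    by have [_ ->] := Hg h1; rewrite // eq_sym (negbTE hh).
rewrite I0; apply/seteqP; split=> // x _ /=.
have [k _ rK] := aut_bij (rho h0); rewrite -[x]rK.
have := z _ (span_gen (vac V) (-1) (k x)).
by rewrite ffunE vY_vac eqxx.
Qed.

(* Artin's independence of automorphisms, with simplicity of V in place of
   invertibility of nonzero elements. *)
Lemma galois_density (S : set {ffun gT -> V}) : subspace S ->
  (forall u n v, S [ffun h => vY u n (rho h v)]) -> forall f, S f.
Proof.
move=> sS H f; have [f' Sf' f'E] := span_prescribe f (enum_uniq gT).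
suff -> : f = f' by apply: Sf'.
by apply/ffunP => h; rewrite f'E // mem_enum.
Qed.

End GaloisDensity.

(** * Twisted modes *)

Section RootsOfUnity.
Context {R : realType}.
Local Notation C := R[i].

Lemma cisD (x y : R) : cis (x + y) = cis x * cis y.
Proof.
rewrite /cis cosD sinD; apply/eqP.
by rewrite eq_complex /= [sin x * _ + _]addrC !eqxx.
Qed.

Lemma cis0 : cis 0 = 1 :> C.
Proof. by rewrite /cis cos0 sin0. Qed.

Lemma root_expD (r s : int) (T : nat) :
  @root_exp R (r + s) T = @root_exp R r T * @root_exp R s T.
Proof. by rewrite /root_exp -cisD intrD; congr cis; ring. Qed.

Lemma root_exp0 (T : nat) : @root_exp R 0 T = 1.
Proof. by rewrite /root_exp mulr0 mul0r cis0. Qed.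

Lemma root_exp_nat (r : int) (T k : nat) :
  @root_exp R (r * k%:Z) T = @root_exp R r T ^+ k.
Proof.
elim: k => [|k IH]; first by rewrite mulr0 root_exp0.
by rewrite -addn1 PoszD mulrDr mulr1 root_expD IH exprD.
Qed.

Lemma root_exp_period (r : int) (T : nat) : (0 < T)%N ->
  @root_exp R (r * T%:Z) T = 1.
Proof.
move=> T0; have Tn : (T%:R : R) != 0 by rewrite pnatr_eq0 -lt0n.
suff E (n : nat) : @root_exp R (n%:Z * T%:Z) T = 1.
  case: r => n; first exact: E.
  have := root_expD (n.+1%:Z * T%:Z) (Negz n * T%:Z) T.
  by rewrite -mulrDl NegzE addrN mul0r root_exp0 E mul1r.
rewrite mulrC root_exp_nat.
suff -> : @root_exp R T T = 1 by rewrite expr1n.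
rewrite /root_exp -[T%:~R]/(T%:R) mulfK // /cis.
have -> : 2%:R * pi = pi *+ 2 :> R by rewrite mulr_natl.
by rewrite cos2pi mulr2n sinD sinpi mul0r mulr0 addr0.
Qed.

Lemma root_exp_neq1 (T k : nat) : (0 < k < T)%N -> @root_exp R k T != 1.
Proof.
move=> /andP[k0 kT]; apply/eqP; rewrite /root_exp /cis => /eqP.
rewrite eq_complex /= => /andP[/eqP c1 _].
have T0 : (0 : R) < T%:R by rewrite ltr0n; lia.
(* Half the argument: cos (2 x) = 1 would force sin x = 0, although 0 < x < pi. *)
pose x : R := pi * k%:R / T%:R.
have xpos : 0 < x by rewrite /x divr_gt0 // mulr_gt0 ?pi_gt0 // ltr0n.
have xpi : x < pi.
  by rewrite /x ltr_pdivrMr // ltr_pM2l ?pi_gt0 // ltr_nat.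
have : 0 < sin x by apply: sin_gt0_pi; rewrite xpos xpi.
move: c1; have -> : 2%:R * pi * k%:~R / T%:R = x *+ 2.
  by rewrite /x -[k%:~R]/(k%:R) -mulr_natl; ring.
rewrite cos_mulr2n cos2sin2 => h s0.
have : sin x ^+ 2 = 0 by lra.
by move/eqP; rewrite sqrf_eq0 => /eqP s00; rewrite s00 ltxx in s0.
Qed.

Lemma root_exp_sum (T j : nat) : (0 < j < T)%N ->
  \sum_(r < T) @root_exp R (- (r%:Z * j%:Z)) T = 0.
Proof.
move=> jT; have T0 : (0 < T)%N by lia.
pose w := @root_exp R (- j%:Z) T.
have w1 : w != 1.
  apply: contra_neq (root_exp_neq1 jT) => w1.
  have := root_expD j (- j%:Z) T.
  by rewrite addrN root_exp0 -/w w1 mulr1.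
have E r : @root_exp R (- (r%:Z * j%:Z)) T = w ^+ r.
  by rewrite -root_exp_nat; congr root_exp; ring.
under eq_bigr do rewrite E.
have /eqP := subrX1 w T; rewrite -root_exp_nat root_exp_period // subrr.
by rewrite eq_sym mulf_eq0 subr_eq0 (negbTE w1) => /eqP.
Qed.

End RootsOfUnity.

Section EigenDecomposition.
Context {R : realType} {V : vosa R} (g : aut V) (T : nat).
Local Notation C := R[i].
Hypotheses (T0 : (0 < T)%N) (gT1 : iter T g =1 id).

Lemma iter_aut_linear n : linear (iter n g).
Proof. by elim: n => [|n IH] a x y //=; rewrite IH aut_linear. Qed.

Definition eigenproj (r : nat) (v : V) : V :=
  (T%:R^-1 : C) *: \sum_(j < T) @root_exp R (- (r%:Z * j%:Z)) T *: iter j g v.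

Lemma eigenproj_eigen (r : nat) v : g (eigenproj r v) = @root_exp R r T *: eigenproj r v.
Proof.
rewrite /eigenproj (linZ (aut_linear g)) [RHS]scalerA mulrC -scalerA.
congr (_ *: _); rewrite (lin_sum (aut_linear g)) scaler_sumr.
pose F (j : nat) := @root_exp R (r%:Z - r%:Z * j%:Z) T *: iter j g v.
transitivity (\sum_(j < T) F j.+1).
  apply: eq_bigr => j _; rewrite (linZ (aut_linear g)) /F; congr (@root_exp R _ T *: _).
  by rewrite -addn1 PoszD; ring.
transitivity (\sum_(j < T) F j); last first.
  by apply: eq_bigr => j _; rewrite /F root_expD scalerA.
have FT : F T = F 0%N.
  rewrite /F gT1 /= mulr0 subr0; congr (_ *: _).
  by rewrite root_expD -mulNr root_exp_period // mulr1.
move: F FT => F FT; case: T T0 FT => [//|n] _ FT.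
by rewrite big_ord_recr big_ord_recl /= addrC FT.
Qed.

Lemma eigenproj_sum v : \sum_(r < T) eigenproj r v = v.
Proof.
rewrite /eigenproj -scaler_sumr exchange_big /=.
have -> : \sum_(j < T) \sum_(r < T) @root_exp R (- (r%:Z * j%:Z)) T *: iter j g v
   = (T%:R : C) *: v.
  rewrite (bigD1 (Ordinal T0)) //= [X in _ + X]big1 ?addr0.
    have z (r : nat) : @root_exp R (- (r%:Z * 0%N%:Z)) T = 1.
      by rewrite mulr0 oppr0 root_exp0.
    under eq_bigr do rewrite z scale1r.
    by rewrite sumr_const card_ord scaler_nat.
  move=> j j0; rewrite -scaler_suml root_exp_sum ?scale0r //.
  by rewrite ltn_ord andbT lt0n; apply: contra j0 => /eqP j0; apply/eqP/val_inj.
by rewrite scalerA mulVf ?scale1r // pnatr_eq0 -lt0n.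
Qed.

Lemma eigenproj_parity i r v :
  parity (@vgr R V) i v -> parity (@vgr R V) i (eigenproj r v).
Proof.
move=> pv; apply: subspaceZ; first exact: parity_subspace.
apply: subspace_sum => [|j _]; first exact: parity_subspace.
apply: subspaceZ; first exact: parity_subspace.
by elim: (j : nat) => //= n IH; apply: aut_parity.
Qed.

End EigenDecomposition.

Section TwistedModes.
Context {R : realType} {V : vosa R} {g : aut V} {T : nat} (M : weak_twisted g T).
Local Notation C := R[i].
Hypotheses (T0 : (0 < T)%N) (gT1 : iter T g =1 id).
Local Notation P := (eigenproj g T).
Local Notation Y := (@mY R V g T M).

Lemma coset_exists (n : rat) : T%:R * n \is a Num.int ->
  exists r : 'I_T, in_coset (r%:R / T%:R) n.
Proof.
have Tq : (T%:R : rat) != 0 by rewrite pnatr_eq0 -lt0n.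
have Tz : T%:Z != 0 by lia.
move=> /intrP[z zE].
have r0 := modz_ge0 z Tz; have rT := ltz_pmod z (T0 : 0 < T%:Z).
have rT' : (`|(z %% T)%Z| < T)%N by lia.
exists (Ordinal rT'); rewrite /in_coset /=.
have -> : n = z%:~R / T%:R by rewrite -zE mulrC mulKf.
rewrite {1}(divz_eq z T) intrD intrM -[T%:~R]/(T%:R : rat).
have -> : (`|(z %% T)%Z|%N%:R : rat) = (z %% T)%Z%:~R.
  by rewrite -[LHS]/((`|(z %% T)%Z|%N%:Z)%:~R) gez0_abs.
by rewrite mulrDl addrK mulfK // intr_int.
Qed.

Lemma coset_inj (r s : 'I_T) :
  (r%:R / T%:R - s%:R / T%:R : rat) \is a Num.int -> r = s.
Proof.
have Tq : (0 : rat) < T%:R by rewrite ltr0n.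
rewrite -mulrBl => /intrP[z /eqP].
rewrite -[_ == _](inj_eq (mulIf (lt0r_neq0 Tq))) divfK ?lt0r_neq0 // => /eqP zE.
have {}zE : (r%:Z - s%:Z)%:~R = (z * T%:Z)%:~R :> rat by rewrite intrB intrM.
have /(intr_inj (R := rat)) {}zE := zE.
have := ltn_ord r; have := ltn_ord s => sT rT.
apply: ord_inj.
have : z * T%:Z < 1 * T%:Z by lia.
have : - 1 * T%:Z < z * T%:Z by lia.
have Tz : 0 < T%:Z by lia.
rewrite !ltr_pM2r // => z1 z2; have z0 : z = 0 by lia.
by rewrite z0 in zE; lia.
Qed.

(** The modes n of the other eigencomponents vanish, so the class of n mod Z selects the
    component. *)
Lemma mY_coset (r : 'I_T) v n w : in_coset (r%:R / T%:R) n ->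
  Y v n w = Y (P r v) n w.
Proof.
move=> rn; rewrite -{1}(eigenproj_sum g T0 v) (lin_sum (@mY_linl _ _ _ _ M n w)).
rewrite (bigD1 r) //= big1 ?addr0 // => s sr.
apply: mY_eigen (eigenproj_eigen T0 gT1 s v) _ _ _ => sn.
move/eqP: sr; apply; apply: coset_inj.
have -> : (s%:R / T%:R - r%:R / T%:R : rat)
   = (n - r%:R / T%:R) - (n - s%:R / T%:R) by ring.
by rewrite rpredB.
Qed.

Lemma mY_borcherds (r : nat) i j (u v : V) (w : M) :
  parity (@vgr R V) i u -> parity (@vgr R V) j v ->
  borcherds (r%:R / T%:R) ((-1) ^+ (i && j))
    (fun m n => Y (P r u) m (Y v n w))
    (fun n m => Y v n (Y (P r u) m w)) (fun k l => Y (vY (P r u) k v) l w).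
Proof.
move=> pu pv; have pru := eigenproj_parity g T r pu.
have J := mY_jacobi (w0 := M) (eigenproj_eigen T0 gT1 r u) pru pv.
apply: jacobi_borcherds J => *;
  by [exact: mY_linl|exact: mY_linr|exact: mY_trunc|exact: vY_trunc].
Qed.

End TwistedModes.

(** * Averaging *)

Section Transfer.
Context {R : realType} {V : vosa R} (sV : simple_vosa V).
Context {gT : finGroupType} (rho : gT -> aut V).
Hypothesis rhoM : forall x y, rho (x * y)%g =1 rho x \o rho y.
Hypothesis rho_inj : forall x y, rho x =1 rho y -> x = y.
Context {g : aut V} {T : nat} (M : weak_twisted g T).
Hypotheses (T0 : (0 < T)%N) (gT1 : iter T g =1 id).
Local Notation C := R[i].
Local Notation P := (eigenproj g T).
Local Notation Y := (@mY R V g T M).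
Local Notation par := (parity (@vgr R V)).

Lemma rho1 v : rho 1%g v = v.
Proof.
have [k kK _] := aut_bij (rho 1%g).
by have := rhoM 1%g 1%g v; rewrite mulg1 => /(congr1 k); rewrite /= !kK.
Qed.

Lemma rhoVK h v : rho h (rho h^-1%g v) = v.
Proof. by have := rhoM h h^-1%g v; rewrite mulgV rho1. Qed.

Lemma rho_trace_fixed h v : rho h (\sum_x rho x v) = \sum_x rho x v.
Proof.
rewrite (lin_sum (aut_linear _)) [RHS](reindex_inj (mulgI h)) /=.
by apply: eq_bigr => x _; rewrite rhoM.
Qed.

Lemma mY_nonfrac v n w : (forall r : 'I_T, ~ in_coset (r%:R / T%:R) n) -> Y v n w = 0.
Proof.
move=> nr; apply: mY_frac; apply/negP => /(coset_exists T0)[r]; exact: nr.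
Qed.

(** For each eigencomponent of u, the products (P r u)_m (h b)_n y_h sum to 0 because the outer mode
    does not depend on h. The iterates follow, and the components of u are then added up. *)
Lemma mY_iterate_kernel (y : {ffun gT -> M}) :
  (forall b n, \sum_h Y (rho h b) n (y h) = 0) ->
  forall u k b l, \sum_h Y (vY u k (rho h b)) l (y h) = 0.
Proof.
move=> y0 u k b l.
have [/intrP[z ->]|nk] := boolP (k \is a Num.int); last first.
  by rewrite big1 // => h _; rewrite vY_int // (lin0 (mY_linl l _)).
move: u; apply: parity_span.
  apply: (subspace_preimage (f := fun u => \sum_h Y (vY u z%:~R (rho h b)) l (y h)))
    (@subspace_set0 _ _).
  apply: linear_bigsum => h; apply: (linear_comp (mY_linl l (y h))).
  exact: vY_linl.
move=> i u pu /=; move: b; apply: parity_span.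
  apply: (subspace_preimage (f := fun b => \sum_h Y (vY u z%:~R (rho h b)) l (y h)))
    (@subspace_set0 _ _).
  apply: linear_bigsum => h; apply: (linear_comp (mY_linl l (y h))).
  by apply: linear_comp (aut_linear _); exact: vY_linr.
move=> j b pb /=.
have E0 (r : nat) : \sum_h Y (vY (P r u) z%:~R (rho h b)) l (y h) = 0.
  apply: (borcherds_iterate (borcherds_sum (fun h =>
    mY_borcherds T0 gT1 r (y h) pu (aut_parity (rho h) pb))) (@subspace_set0 _ _)).
  move=> m n _ /=; rewrite -(lin_sum (mY_linr (w0 := M) (P r u) m)) y0.
  exact: lin0 (mY_linr _ _).
rewrite -(eigenproj_sum g T0 u).
under eq_bigr do rewrite (lin_sum (vY_linl _ _)) (lin_sum (@mY_linl _ _ _ _ M l _)).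
by rewrite exchange_big /= big1.
Qed.

Let single (h0 : gT) {X : lmodType C} (x : X) : {ffun gT -> X} :=
  [ffun h => if h == h0 then x else 0].

Lemma sum_single (h0 : gT) (X X' : lmodType C) (F : gT -> X -> X') x :
  (forall h, linear (F h)) -> \sum_h F h (single h0 x h) = F h0 x.
Proof.
move=> lF; rewrite (bigD1 h0) //= ffunE eqxx big1 ?addr0 // => h hh.
by rewrite ffunE (negbTE hh) (lin0 (lF h)).
Qed.

(** By density the coefficients h(b) may be replaced by any family in V. The vacuum at h0 and 0
    elsewhere, with mode -1, isolates y h0. *)
Lemma orbit_kernel (y : {ffun gT -> M}) :
  (forall b n, \sum_h Y (rho h b) n (y h) = 0) -> y = 0.
Proof.
move=> /mY_iterate_kernel H.
have S0 : forall f : {ffun gT -> V}, forall l, \sum_h Y (f h) l (y h) = 0.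
  apply: (galois_density sV rho_inj (S := [set f | forall l, _ = 0])).
    split=> [|a f1 f2 h1 h2] l.
      by rewrite big1 // => h _; rewrite ffunE (lin0 (mY_linl l _)).
    transitivity (a *: (\sum_h Y (f1 h) l (y h)) + \sum_h Y (f2 h) l (y h)).
      rewrite scaler_sumr -big_split.
      by apply: eq_bigr => h _; rewrite !ffunE mY_linl.
    by rewrite h1 h2 scaler0 addr0.
  move=> u n v l /=; rewrite -[RHS](H u n v l).
  by apply: eq_bigr => h _; rewrite ffunE.
apply/ffunP => h0; rewrite ffunE -[RHS](S0 (single h0 (vac V)) (-1)).
rewrite (@sum_single h0 _ _ (fun h x => Y x (-1) (y h))) ?mY_vac ?eqxx //.
by move=> h; exact: mY_linl.
Qed.

(** The surjectivity that goes with [orbit_kernel]: constant families and modes generate everything.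
    It gives the existence of the averaged map, the kernel statement its uniqueness. *)
Lemma orbit_span (S : set {ffun gT -> M}) : subspace S ->
  (forall w, S [ffun=> w]) ->
  (forall c m x, S x -> S [ffun h => Y (rho h c) m (x h)]) ->
  forall h0 x, S (single h0 x).
Proof.
move=> sS Sc SY.
have gen u k v l x : S [ffun h => Y (vY (rho h u) k v) l x].
  have [/intrP[z ->]|nk] := boolP (k \is a Num.int); last first.
    rewrite (_ : [ffun _ => _] = 0); first by case: sS.
    by apply/ffunP => h; rewrite !ffunE vY_int // (lin0 (mY_linl l _)).
  move: u; apply: parity_span.
    apply: (subspace_preimage (f := fun u => [ffun h => Y (vY (rho h u) z%:~R v) l x])) => //.
    apply: ffun_linear => h; apply: (linear_comp (mY_linl l x)).
    by apply: (linear_comp (vY_linl _ _)); exact: aut_linear.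
  move=> i u pu /=; move: v; apply: parity_span.
    apply: (subspace_preimage (f := fun v => [ffun h => Y (vY (rho h u) z%:~R v) l x])) => //.
    by apply: ffun_linear => h; apply: (linear_comp (mY_linl l x)); exact: vY_linr.
  move=> j v pv /=.
  have SE (r : 'I_T) : S [ffun h => Y (vY (P r (rho h u)) z%:~R v) l x].
    apply: (borcherds_iterate (borcherds_ffun (fun h =>
      mY_borcherds T0 gT1 r x (aut_parity (rho h) pu) pv)) sS).
    move=> m n mr /=.
    rewrite (_ : [ffun _ => _] = [ffun h => Y (rho h u) m ([ffun=> Y v n x] h)]).
      exact/SY/Sc.
    by apply/ffunP => h; rewrite !ffunE -(mY_coset T0 gT1).
  rewrite (_ : [ffun _ => _] =
      \sum_(r < T) [ffun h => Y (vY (P r (rho h u)) z%:~R v) l x]).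
    exact: subspace_sum.
  apply/ffunP => h; rewrite sum_ffunE ffunE -[in LHS](eigenproj_sum g T0 (rho h u)).
  rewrite (lin_sum (vY_linl _ _)) (lin_sum (mY_linl l x)).
  by apply: eq_bigr => r _; rewrite ffunE.
have all (f : {ffun gT -> V}) l x : S [ffun h => Y (f h) l x].
  (* Density concerns the families u_n (h v), whereas [gen] provides (h u)_n v. The substitution f
     |-> (h (f (h^-1)))_h turns the former into the latter, and it is invertible. *)
  have G : forall f : {ffun gT -> V}, S [ffun h => Y (rho h (f h^-1%g)) l x].
    apply: (galois_density sV rho_inj
              (S := [set f | S [ffun h => Y (rho h (f h^-1%g)) l x]])).
      apply: (subspace_preimage (f := fun f : {ffun gT -> V} =>
        [ffun h => Y (rho h (f h^-1%g)) l x])) => //.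
      apply: ffun_linear => h; apply: (linear_comp (mY_linl l x)).
      by apply: linear_comp => [|a f1 f2]; [exact: aut_linear|rewrite !ffunE].
    move=> u n v /=.
    rewrite (_ : [ffun _ => _] = [ffun h => Y (vY (rho h u) n v) l x]) //.
    by apply/ffunP => h; rewrite !ffunE aut_Y rhoVK.
  have := G [ffun h => rho h (f h^-1%g)]; congr S.
  by apply/ffunP => h; rewrite !ffunE invgK rhoVK.
move=> h0 x; have := all (single h0 (vac V)) (-1) x; congr S.
apply/ffunP => h; rewrite !ffunE; case: eqP => _; first by rewrite mY_vac eqxx.
exact: lin0 (mY_linl _ _).
Qed.

Context (p : M -> M) (lp : linear p).
Hypothesis pG : forall v, (forall h, rho h v = v) ->
  forall n w, p (Y v n w) = Y v n (p w).

(* For commutative A Galois over A^G this is the graph of id (x) p on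
   A (x)_{A^G} M = \prod_h M, where a (x) w is identified with (h(a) w)_h. *)
Let rel (x y : {ffun gT -> M}) : Prop :=
  forall a n, p (\sum_h Y (rho h a) n (x h)) = \sum_h Y (rho h a) n (y h).

Let rel_lin c x y x' y' : rel x y -> rel x' y' -> rel (c *: x + x') (c *: y + y').
Proof.
move=> H H' a n.
have E (z z' : {ffun gT -> M}) : \sum_h Y (rho h a) n ((c *: z + z') h)
    = c *: (\sum_h Y (rho h a) n (z h)) + \sum_h Y (rho h a) n (z' h).
  rewrite scaler_sumr -big_split; apply: eq_bigr => h _.
  by rewrite !ffunE mY_linr.
by rewrite !E lp H H'.
Qed.

Let rel0 : rel 0 0.
Proof.
move=> a n; rewrite !big1 ?(lin0 lp) // => h _; rewrite ffunE;
  exact: lin0 (mY_linr _ _).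
Qed.

(** For a constant family the sum is a mode of the trace of a, which lies in V^G, and [p] commutes
    with such modes. *)
Let rel_const w : rel [ffun=> w] [ffun=> p w].
Proof.
move=> a n.
have E z : \sum_h Y (rho h a) n ([ffun=> z] h) = Y (\sum_h rho h a) n z.
  by rewrite (lin_sum (mY_linl n z)); apply: eq_bigr => h _; rewrite ffunE.
by rewrite !E; apply: pG => h; exact: rho_trace_fixed.
Qed.

(** The sum over s of the iterates (P s (h a))_k (h c) is h(a_k c), so [rel x y] makes the sum over
    s of the defects [E s] vanish. A single s is out of reach, as [P s] need not commute with h;
    [borcherds_separate] nevertheless gives the vanishing of each product defect [D s]. *)
Let rel_mode c m x y : rel x y ->
  rel [ffun h => Y (rho h c) m (x h)] [ffun h => Y (rho h c) m (y h)].
Proof.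
move=> xy.
have E : forall c a n, p (\sum_h Y (rho h a) n (Y (rho h c) m (x h)))
    - \sum_h Y (rho h a) n (Y (rho h c) m (y h)) = 0; last first.
  move=> a n; apply: subr0_eq; rewrite -[RHS](E c a n).
  by congr (p _ - _); apply: eq_bigr => h _; rewrite ffunE.
move=> {}c a n.
have [[r rn]|/forallNP nr] := pselect (exists r : 'I_T, in_coset (r%:R / T%:R) n);
    last first.
  by rewrite !big1 ?(lin0 lp) ?subrr // => h _; rewrite mY_nonfrac.
move: c; apply: parity_span.
  apply: (subspace_preimage (f := fun c =>
    p (\sum_h Y (rho h a) n (Y (rho h c) m (x h)))
      - \sum_h Y (rho h a) n (Y (rho h c) m (y h)))) (@subspace_set0 _ _).
  apply: linear_sub; first apply: (linear_comp lp);
    apply: linear_bigsum => h; apply: (linear_comp (mY_linr _ _));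
    by apply: (linear_comp (mY_linl _ _)); exact: aut_linear.
move=> j c pc /=; move: a; apply: parity_span.
  apply: (subspace_preimage (f := fun a =>
    p (\sum_h Y (rho h a) n (Y (rho h c) m (x h)))
      - \sum_h Y (rho h a) n (Y (rho h c) m (y h)))) (@subspace_set0 _ _).
  apply: linear_sub; first apply: (linear_comp lp);
    by apply: linear_bigsum => h; apply: (linear_comp (mY_linl _ _));
       exact: aut_linear.
move=> i a pa /=.
pose D (s : 'I_T) m' n' :=
  \sum_h (p (Y (P s (rho h a)) m' (Y (rho h c) n' (x h)))
          - Y (P s (rho h a)) m' (Y (rho h c) n' (y h))).
suff : D r n m = 0.
  rewrite /D sumrB (lin_sum lp); move=> Dr; rewrite -[RHS]Dr.
  by congr (_ - _); apply: eq_bigr => h _; rewrite -(mY_coset T0 gT1).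
pose E (s : 'I_T) k l :=
  \sum_h (p (Y (vY (P s (rho h a)) k (rho h c)) l (x h))
          - Y (vY (P s (rho h a)) k (rho h c)) l (y h)).
have B (s : 'I_T) : exists D', borcherds (s%:R / T%:R) ((-1) ^+ (i && j)) (D s) D' (E s).
  exists (fun n' m' => \sum_h (p (Y (rho h c) n' (Y (P s (rho h a)) m' (x h)))
          - Y (rho h c) n' (Y (P s (rho h a)) m' (y h)))).
  apply: borcherds_sum => h; have pha := aut_parity (rho h) pa.
  have phc := aut_parity (rho h) pc.
  apply: borcherdsB; last exact: mY_borcherds.
  by apply: borcherds_lin lp _; exact: mY_borcherds.
have {B} /choice[D' B] := B.
apply: (borcherds_separate (@coset_inj T T0) B) rn => k l.
rewrite exchange_big /=.
have phi h : linear (fun u => p (Y (vY u k%:~R (rho h c)) l (x h))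
    - Y (vY u k%:~R (rho h c)) l (y h)).
  apply: linear_sub; first apply: (linear_comp lp);
    by apply: (linear_comp (mY_linl _ _)); exact: vY_linl.
under eq_bigr do rewrite -(lin_sum (phi _)) (eigenproj_sum g T0) -aut_Y.
by rewrite sumrB -(lin_sum lp) xy subrr.
Qed.

Let rel_uniq x y y' : rel x y -> rel x y' -> y = y'.
Proof.
move=> H H'; apply/eqP; rewrite -subr_eq0; apply/eqP; apply: orbit_kernel => b n.
transitivity (\sum_h Y (rho h b) n (y h) - \sum_h Y (rho h b) n (y' h)).
  rewrite -sumrB; apply: eq_bigr => h _; rewrite !ffunE.
  exact: linB (mY_linr _ _) _ _.
by rewrite -H -H' subrr.
Qed.

Context (W : set M) (sW : subspace W).
Hypothesis WY : forall v n w, W w -> W (Y v n w).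
Hypothesis pW : forall w, W (p w).
Hypothesis pid : forall w, W w -> p w = w.

(** q x is the entry at 1 of the family related to the one with x at 1 and 0 elsewhere. On families
    supported at 1 the modes of h(v) reduce to those of v, so uniqueness yields V-linearity. Values
    stay in W because every generating operation preserves W; for w in W the family is related to
    itself. *)
Lemma linear_projection : exists q : M -> M,
  [/\ linear q, forall v n w, q (Y v n w) = Y v n (q w),
      forall w, W (q w) & forall w, W w -> q w = w].
Proof.
have /choice[y Hy] x : exists y, rel (single 1%g x) y /\ forall h, W (y h).
  apply: (@orbit_span [set x | exists y, rel x y /\ forall h, W (y h)]).
  - split.
      exists 0; split; first exact: rel0.
      by move=> h; rewrite ffunE; case: sW.
    move=> c x1 x2 [y1 [r1 W1]] [y2 [r2 W2]]; exists (c *: y1 + y2); split.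
      exact: rel_lin.
    by move=> h; rewrite !ffunE; case: sW => _; apply.
  - move=> w; exists [ffun=> p w]; split; first exact: rel_const.
    by move=> h; rewrite ffunE.
  - move=> c m x1 [y1 [r1 W1]]; exists [ffun h => Y (rho h c) m (y1 h)]; split.
      exact: rel_mode.
    by move=> h; rewrite ffunE; apply: WY.
exists (fun x => y x 1%g); split.
- move=> c x1 x2; rewrite (_ : y _ = c *: y x1 + y x2) ?ffunE //.
  have [r1 _] := Hy x1; have [r2 _] := Hy x2.
  apply: rel_uniq (proj1 (Hy _)) _; have := rel_lin c r1 r2.
  congr rel; apply/ffunP => h; rewrite !ffunE.
  by case: eqP => _ //; rewrite scaler0 addr0.
- move=> v n w; rewrite (_ : y _ = [ffun h => Y (rho h v) n (y w h)]) ?ffunE ?rho1 //.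
  apply: rel_uniq (proj1 (Hy _)) _; have := rel_mode v n (proj1 (Hy w)).
  congr rel; apply/ffunP => h; rewrite !ffunE.
  by case: eqP => [->|_]; rewrite ?rho1 // (lin0 (mY_linr _ _)).
- by move=> w; have [_] := Hy w.
- move=> w Ww; rewrite (_ : y w = single 1%g w) ?ffunE ?eqxx //.
  apply: rel_uniq (proj1 (Hy _)) _ => a n.
  rewrite (@sum_single 1%g _ _ (fun h z => Y (rho h a) n z)).
    by apply: pid; apply: WY.
  by move=> h; exact: mY_linr.
Qed.

End Transfer.

(** * Complete reducibility *)

Section SemisimpleOperators.
Context {C : fieldType} {W : lmodType C} (ops : set (W -> W)).
Hypothesis ops_linear : forall f, ops f -> linear f.
Implicit Types A B N U : set W.

Definition invariant N : Prop :=
  subspace N /\ forall f, ops f -> forall x, N x -> N (f x).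

Definition irreducible N : Prop :=
  [/\ invariant N, N <> [set 0]
    & forall N', invariant N' -> N' `<=` N -> N' = [set 0] \/ N' = N].

Definition addset A B : set W := [set x | exists a b, [/\ A a, B b & x = a + b]].

Definition complements U U' : Prop :=
  [/\ invariant U', forall x, U x -> U' x -> x = 0 & addset U U' = setT].

Let inv0 N : invariant N -> N 0.
Proof. by case=> -[]. Qed.

Lemma subset_addl A B : B 0 -> A `<=` addset A B.
Proof. by move=> B0 x Ax; exists x, 0; rewrite addr0. Qed.

Lemma subset_addr A B : A 0 -> B `<=` addset A B.
Proof. by move=> A0 x Bx; exists 0, x; rewrite add0r. Qed.

Let ops0 f : ops f -> f 0 = 0.
Proof.
by move=> /ops_linear lf; have := lf (-1) 0 0; rewrite scaler0 addr0 scaleN1r addNr.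
Qed.

Let opsD f x y : ops f -> f (x + y) = f x + f y.
Proof. by move=> /ops_linear lf; have := lf 1 x y; rewrite !scale1r. Qed.

Lemma invariant_add A B : invariant A -> invariant B -> invariant (addset A B).
Proof.
move=> [sA oA] [sB oB]; split; first split.
- by exists 0, 0; rewrite addr0; split=> //; [case: sA|case: sB].
- move=> c _ _ [a [b [Aa Bb ->]]] [a' [b' [Aa' Bb' ->]]].
  exists (c *: a + a'), (c *: b + b'); split.
  + by case: sA => _; apply.
  + by case: sB => _; apply.
  + by rewrite scalerDr addrACA.
- move=> f of_ _ [a [b [Aa Bb ->]]]; exists (f a), (f b).
  by rewrite opsD //; split=> //; [apply: oA|apply: oB].
Qed.

Lemma invariantI A B : invariant A -> invariant B -> invariant (A `&` B).
Proof.
move=> [sA oA] [sB oB]; split; first exact: subspaceI.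
by move=> f of_ x [Ax Bx]; split; [apply: oA|apply: oB].
Qed.

Lemma sumspace_subspace (I : choiceType) (N : I -> set W) :
  (forall i, subspace (N i)) -> subspace (sumspace N).
Proof.
move=> sN; split; first by exists [::], (fun=> 0); split=> //; rewrite big_nil.
move=> c _ _ [s [f [us Nf ->]]] [s' [f' [us' Nf' ->]]].
pose F i := c *: (if i \in s then f i else 0) + (if i \in s' then f' i else 0).
exists (undup (s ++ s')), F; split; first exact: undup_uniq.
  move=> i _; have [N0 ND] := sN i; apply: ND; case: ifP => //; first exact: Nf.
  exact: Nf'.
have sumE (r : seq I) (k : I -> W) : uniq r -> {subset r <= s ++ s'} ->
    \sum_(j <- r) k j = \sum_(j <- undup (s ++ s')) (if j \in r then k j else 0).
  move=> ur rt; rewrite -big_mkcond -[RHS]big_filter; apply: perm_big.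
  apply: uniq_perm => //; first by rewrite filter_uniq // undup_uniq.
  move=> j; rewrite mem_filter mem_undup.
  by case jr: (j \in r) => //=; rewrite rt.
rewrite (sumE s) // ?(sumE s') //; first by rewrite scaler_sumr -big_split.
  by move=> j js; rewrite mem_cat js orbT.
by move=> j js; rewrite mem_cat js.
Qed.

Lemma sumspace_in (I : choiceType) (N : I -> set W) i : N i `<=` sumspace N.
Proof.
move=> x Nx; exists [:: i], (fun=> x); split=> //; last by rewrite big_seq1.
by move=> j; rewrite inE => /eqP ->.
Qed.

Lemma sumspace_sub (I : choiceType) (N : I -> set W) (S : set W) :
  subspace S -> (forall i, N i `<=` S) -> sumspace N `<=` S.
Proof.
move=> sS NS _ [s [f [us Nf ->]]]; rewrite big_seq; apply: subspace_sum => // i.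
by move=> /Nf; apply: NS.
Qed.

Lemma invariant_sumspace (I : choiceType) (N : I -> set W) :
  (forall i, invariant (N i)) -> invariant (sumspace N).
Proof.
move=> iN; split; first by apply: sumspace_subspace => i; case: (iN i).
move=> f of_ _ [s [h [us Nh ->]]]; exists s, (fun i => f (h i)); split=> //.
  by move=> i /Nh; case: (iN i) => _; apply.
by elim/big_rec2: _ => [|i y x _ <-]; rewrite ?ops0 ?opsD.
Qed.

Lemma invariant_maximal (Q : set W) : Q 0 ->
  exists A, [/\ invariant A, A `<=` Q
    & forall B, invariant B -> B `<=` Q -> A `<=` B -> B = A].
Proof.
move=> Q0.
pose P A := A = set0 \/ invariant A /\ A `<=` Q.
have i0 : invariant [set 0].
  by split=> [|f of_ x /= ->]; [exact: subspace_set0|exact: ops0].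
have [F FP totF|A [PA maxA]] := @Zorn_bigcup W P; last first.
  have [iA AQ] : invariant A /\ A `<=` Q.
    case: PA => // A0; exfalso; apply: (maxA [set 0]).
      rewrite A0; split; first exact: sub0set.
      by move=> /(_ 0 erefl).
    by right; split=> // x ->.
  exists A; split=> // B iB BQ AB; apply: contrapT => nBA.
  apply: (maxA B); last by right.
  by split=> // BA; apply: nBA; apply/seteqP.
have [[X [FX X0]]|noX] := pselect (exists X, F X /\ X <> set0); last first.
  left; apply/seteqP; split=> // x [X FX Xx]; exfalso; apply: noX; exists X.
  by split=> // XE; rewrite XE in Xx.
have iF Y y : F Y -> Y y -> invariant Y /\ Y `<=` Q.
  by move=> FY Yy; case: (FP _ FY) => // YE; rewrite YE in Yy.
have /set0P[x0 Xx0] : X != set0 by apply/eqP.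
right; split; last by move=> y [Y FY Yy]; have [_] := iF _ _ FY Yy; apply.
split; first split.
- by exists X => //; have [[[]]] := iF _ _ FX Xx0.
- move=> c x y [Z FZ Zx] [Y FY Yy].
  have [ZY|YZ] := totF _ _ FZ FY.
    have [[[_ YD] _] _] := iF _ _ FY Yy.
    by exists Y => //; apply: YD => //; apply: ZY.
  have [[[_ ZD] _] _] := iF _ _ FZ Zx.
  by exists Z => //; apply: ZD => //; apply: YZ.
- move=> f of_ x [Y FY Yx]; exists Y => //.
  by have [[_ oY] _] := iF _ _ FY Yx; apply: oY.
Qed.

(** A is maximal among the invariant subspaces meeting U in 0. An irreducible N i not inside U + A
    meets it in 0; then A + N i still meets U in 0, and maximality puts N i inside A. *)
Lemma sum_irreducible_complement (I : choiceType) (N : I -> set W) :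
  (forall i, irreducible (N i)) -> sumspace N = setT ->
  forall U, invariant U -> exists U', complements U U'.
Proof.
move=> irrN sN U iU.
have [//|A [iA AQ maxA]] := @invariant_maximal [set x | U x -> x = 0].
exists A; split=> // [x Ux Ax|]; first exact: (AQ x).
have iUA := invariant_add iU iA.
apply/seteqP; split=> // x _.
suff : sumspace N `<=` addset U A by rewrite sN; apply.
move=> {x}.
apply: sumspace_sub => [|i]; first by case: iUA.
have [iNi Ni0 irr] := irrN i.
have [|K0|<-] := irr _ (invariantI iNi iUA); [by apply: subIsetl| |exact: subIsetr].
suff E : addset A (N i) = A.
  move=> x Nx; apply: subset_addr; first exact: inv0.
  by rewrite -E; apply: subset_addr Nx; exact: inv0.
apply: maxA.
- exact: invariant_add.
- move=> _ [a [n [Aa Nn ->]]] /= Uan.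
  have n0 : n = 0.
    suff : (N i `&` addset U A) n by rewrite K0.
    split=> //; exists (a + n), (- a); split=> //.
      by apply: subspaceN Aa; case: iA.
    by rewrite addrAC subrr add0r.
  by rewrite n0 addr0 in Uan *; apply: (AQ a).
- by apply: subset_addl; exact: inv0.
Qed.

Hypothesis complemented : forall U, invariant U -> exists U', complements U U'.

(** Take A maximal among the invariant subspaces of N that avoid a nonzero vector x0, and a
    complement A' of A. The piece of N in A' is irreducible. *)
Lemma irreducible_inside N : invariant N -> N <> [set 0] ->
  exists2 L, irreducible L & L `<=` N.
Proof.
move=> iN N0.
have [x0 [Nx0 x00]] : exists x, N x /\ x <> 0.
  apply: contrapT => /forallNP H; apply: N0; apply/seteqP; split=> x.
    by move=> Nx; apply: contrapT => x0; apply: (H x).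
  by move=> ->; exact: inv0.
have [|A [iA AQ maxA]] := @invariant_maximal [set y | N y /\ y <> x0].
  by split; [exact: inv0|exact: nesym].
have AN : A `<=` N by move=> y /AQ[].
have nAx0 : ~ A x0 by move=> /AQ[].
have [A' [iA' AA' AT]] := complemented iA.
have x0E K : invariant K -> K `<=` N `&` A' -> K <> [set 0] -> addset A K x0.
  move=> iK KL K0; apply: contrapT => nx0.
  have E : addset A K = A.
    apply: maxA; first exact: invariant_add.
      move=> y yAK; split; last by move=> yx0; apply: nx0; rewrite -yx0.
      have [a [k [Aa Kk ->]]] := yAK.
      by apply: subspaceD; [case: iN|exact: AN|case: (KL _ Kk)].
    by apply: subset_addl; exact: inv0.
  apply: K0; apply/seteqP; split=> k; last by move=> ->; exact: inv0.
  move=> Kk; apply: AA'; last by case: (KL _ Kk).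
  by rewrite -E; apply: subset_addr Kk; exact: inv0.
exists (N `&` A'); last exact: subIsetl.
split; first exact: invariantI.
  move=> L0; have [a [a' [Aa A'a' x0aa']]] : addset A A' x0 by rewrite AT.
  apply: nAx0; rewrite x0aa'; suff -> : a' = 0 by rewrite addr0.
  suff : (N `&` A') a' by rewrite L0.
  split=> //; have -> : a' = x0 - a by rewrite x0aa' addrAC subrr add0r.
  by apply: subspaceB => //; [case: iN|exact: AN].
move=> K iK KL; have [K0|K0] := pselect (K = [set 0]); [by left|right].
have [K' [iK' KK' KT]] := complemented iK.
have iLK' := invariantI (invariantI iN iA') iK'.
(* Otherwise x0 lies in both A + K and A + (N [&] A' [&] K'). Comparing the components in A' gives a
   vector of K and K', which is 0, so x0 would lie in A. *)
have L'0 : (N `&` A') `&` K' = [set 0].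
  apply: contrapT => L'0.
  have [a [k [Aa Kk x0k]]] := x0E K iK KL K0.
  have [a1 [l [Aa1 [[Nl A'l] K'l] x0l]]] := x0E _ iLK' (@subIsetl _ _ _) L'0.
  have E : k - l = 0.
    apply: AA'; last first.
      by apply: subspaceB => //; [case: iA'|case: (KL _ Kk)].
    have -> : k - l = a1 - a.
      apply/eqP; rewrite subr_eq addrAC eq_sym subr_eq; apply/eqP.
      by rewrite -x0l x0k addrC.
    by apply: subspaceB => //; case: iA.
  have k0 : k = 0 by apply: KK' => //; rewrite (subr0_eq E).
  by apply: nAx0; rewrite x0k k0 addr0.
apply/seteqP; split=> // l Ll.
have [k [k' [Kk K'k' lE]]] : addset K K' l by rewrite KT.
suff k'0 : k' = 0 by rewrite lE k'0 addr0.
suff : ((N `&` A') `&` K') k' by rewrite L'0.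
split=> //; have -> : k' = l - k by rewrite lE addrAC subrr add0r.
apply: subspaceB; [|exact: Ll|exact: KL].
by case: (invariantI iN iA').
Qed.

(** A maximal independent set of irreducibles exists by Zorn's lemma. If its sum had a nonzero
    complement, an irreducible inside that complement could be added. *)
Lemma direct_sum_irreducible :
  exists (I : choiceType) (N : I -> set W),
    (forall i, irreducible (N i)) /\ direct_sum N.
Proof.
pose indep (F : set (set W)) := forall (s : seq {classic (set W)}) (f : set W -> W),
  uniq s -> (forall N, N \in s -> F N /\ N (f N)) ->
  \sum_(N <- s) f N = 0 -> forall N, N \in s -> f N = 0.
pose P (F : set (set W)) := (forall N, F N -> irreducible N) /\ indep F.
have [X XP totX|F [[irrF indF] maxF]] := @Zorn_bigcup (set W) P.
  split=> [N [F /XP[irrF _] FN]|s f us sf]; first exact: irrF.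
  have [F [FP Fs]] : exists F, P F /\ forall N, N \in s -> F N.
    have [[F0 XF0]|noX] := pselect (exists F0, X F0); last first.
      exists set0; split.
        by split=> [N []|s' f' _ sf' _ N /sf' [[]]].
      by move=> N /sf[[F XF]]; exfalso; apply: noX; exists F.
    suff [F XF Fs] : exists2 F, X F & forall N, N \in s -> F N.
      by exists F; split=> //; apply: XP.
    elim: s sf {us} => [|N s IH] sf; first by exists F0.
    have [|F XF Fs] := IH; first by move=> K Ks; apply: sf; rewrite inE Ks orbT.
    have [[F' XF' F'N] _] := sf N (mem_head _ _).
    have [FF'|F'F] := totX _ _ XF XF'.
      exists F' => // K; rewrite inE => /orP[/eqP -> //|/Fs]; exact: FF'.
    by exists F => // K; rewrite inE => /orP[/eqP ->|/Fs //]; exact: F'F.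
  move=> s0; have [_ indF] := FP; apply: indF => // N Ns; split; first exact: Fs.
  by have [] := sf N Ns.
pose I : choiceType := {N : {classic (set W)} | `[< F N >]}.
pose N (i : I) : set W := val i.
have FN i : F (N i) by apply/asboolP; exact: (valP i).
have irrN i : irreducible (N i) by exact: irrF.
exists I, N; split=> //.
have sN i : subspace (N i) by case: (irrN i) => -[].
have iS : invariant (sumspace N) by apply: invariant_sumspace => i; case: (irrN i).
split=> //; last first.
  move=> s f us sf s0 i is_.
  pose f' (K : set W) : W := if insub (K : {classic (set W)}) is Some j then f j else 0.
  have f'E j : f' (val j) = f j by rewrite /f' valK.
  rewrite -f'E; apply: (indF (map val s)).
  - by rewrite map_inj_uniq //; exact: val_inj.
  - by move=> K /mapP[j js ->]; rewrite f'E; split; [exact: FN|exact: sf].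
  - by rewrite big_map -[RHS]s0; apply: eq_bigr => j _.
  - exact: map_f.
have [S' [iS' SS' ST]] := complemented iS.
have [S'0|S'0] := pselect (S' = [set 0]).
  apply/seteqP; split=> // x _.
  have [a [b [Sa S'b ->]]] : addset (sumspace N) S' x by rewrite ST.
  by move: S'b; rewrite S'0 => ->; rewrite addr0.
exfalso; have [L irrL LS'] := irreducible_inside iS' S'0.
have [iL L0 _] := irrL.
have L0' x : L x -> sumspace N x -> x = 0.
  by move=> Lx Sx; apply: SS' => //; apply: LS'.
have FS K x : F K -> K x -> sumspace N x.
  move=> FK Kx; have FK' : `[< F K >] by apply/asboolP.
  exact: (@sumspace_in I N (exist _ (K : {classic (set W)}) FK')).
have nFL : ~ F L.
  move=> FL; apply: L0; apply/seteqP; split=> x; last by move=> ->; exact: inv0.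
  by move=> Lx; apply: L0' => //; exact: FS FL Lx.
apply: (maxF (F `|` [set L])).
  split; first exact: subsetUl.
  by move=> /(_ L); apply: contra_not nFL => H; apply: H; right.
split; first by move=> K [/irrF//|->].
move=> s f us sf s0.
have [sS _] := iS.
have Sf K : K \in s -> K <> L -> sumspace N (f K).
  by move=> /sf[[FK|->]// Kf] _; exact: FS FK Kf.
have fL : (L : {classic (set W)}) \in s -> f L = 0.
  move=> Ls; apply: L0'; first by have [] := sf L Ls.
  have -> : f L = - \sum_(K <- s | K != (L : {classic (set W)})) f K.
    by apply/eqP; rewrite -addr_eq0 -(bigD1_seq (L : {classic (set W)})) // s0.
  apply: subspaceN => //; rewrite big_seq_cond; apply: subspace_sum => // K.
  by move=> /andP[Ks /eqP]; exact: Sf.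
move=> K Ks; have [KL|/eqP KL] := eqVneq K (L : {classic (set W)}).
  by rewrite KL; apply: fL; rewrite -KL.
apply: (indF [seq K <- s | K != (L : {classic (set W)})]).
- exact: filter_uniq.
- move=> K'; rewrite mem_filter => /andP[/eqP K'L /sf[[FK'|]// ?]] //.
- rewrite big_filter.
  have [Ls|Ls] := boolP ((L : {classic (set W)}) \in s).
    by move: s0; rewrite (bigD1_seq (L : {classic (set W)})) //= fL // add0r.
  rewrite -[RHS]s0 big_seq_cond [RHS]big_seq; apply: eq_bigl => K'.
  by case K's: (K' \in s) => //=; apply: contraNneq Ls => <-.
- by rewrite mem_filter Ks andbT; apply/eqP.
Qed.

End SemisimpleOperators.

(** * Graded modules *)

Section Components.
Context {R : realType} {W : lmodType R[i]} {I : choiceType} (U : I -> set W).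
Hypothesis dU : direct_sum U.

Lemma direct_sum_components : exists F : I -> W -> W,
  [/\ forall i, linear (F i), forall i x, U i (F i x),
      forall i j x, U i x -> F j x = if j == i then x else 0
    & forall x, exists s, x = \sum_(i <- s) F i x].
Proof.
have [subU spanU indU] := dU.
have /choice[d Hd] x : exists d : seq I * (I -> W),
    [/\ uniq d.1, forall i, i \in d.1 -> U i (d.2 i) & x = \sum_(i <- d.1) d.2 i].
  have [s [f [us Uf xE]]] : sumspace U x by rewrite spanU.
  by exists (s, f).
pose F i x := if i \in (d x).1 then (d x).2 i else 0.
have UF i x : U i (F i x).
  rewrite /F; case: ifP; last by case: (subU i).
  by have [_ Ud _] := Hd x; apply: Ud.
have FE s f i : uniq s -> (forall i, i \in s -> U i (f i)) ->
    F i (\sum_(i <- s) f i) = if i \in s then f i else 0.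
  move=> us Uf; have [ud Ud E] := Hd (\sum_(i <- s) f i).
  by rewrite /F (direct_sum_eq dU ud us Ud Uf (esym E)).
have Fsum s x : uniq s -> {subset (d x).1 <= s} -> x = \sum_(i <- s) F i x.
  move=> us ds; have [ud _ {1}->] := Hd x.
  rewrite -big_mkcond -[RHS]big_filter; apply: perm_big.
  apply: uniq_perm => //; first exact: filter_uniq.
  by move=> i; rewrite mem_filter; case id_: (i \in (d x).1) => //=; rewrite ds.
exists F; split=> //.
- move=> i a x y; pose s := undup ((d x).1 ++ (d y).1).
  have us : uniq s := undup_uniq _.
  have dx : {subset (d x).1 <= s} by move=> j js; rewrite mem_undup mem_cat js.
  have dy : {subset (d y).1 <= s} by move=> j js; rewrite mem_undup mem_cat js orbT.
  have -> : a *: x + y = \sum_(j <- s) (a *: F j x + F j y).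
    by rewrite big_split -scaler_sumr -!Fsum.
  rewrite FE // => [|j _]; last by case: (subU j) => _; apply.
  case: ifPn => // is_; rewrite /F.
  rewrite (negbTE (contra (dx i) is_)) (negbTE (contra (dy i) is_)).
  by rewrite scaler0 addr0.
- move=> i j x Ux; have := FE [:: i] (fun=> x) j isT.
  rewrite big_seq1 mem_seq1 => -> // k; rewrite mem_seq1 => /eqP ->; exact: Ux.
- move=> x; exists (d x).1; apply: Fsum => //; by have [] := Hd x.
Qed.

Definition component : I -> W -> W := projT1 (cid direct_sum_components).

Lemma component_linear i : linear (component i).
Proof. by have [] := projT2 (cid direct_sum_components). Qed.

Lemma component_in i x : U i (component i x).
Proof. by have [] := projT2 (cid direct_sum_components). Qed.

Lemma component_hom i j x : U i x -> component j x = if j == i then x else 0.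
Proof. by have [_ _ H _] := projT2 (cid direct_sum_components); apply: H. Qed.

Lemma component_sum x : exists s, x = \sum_(i <- s) component i x.
Proof. by have [] := projT2 (cid direct_sum_components). Qed.

Lemma component_id i x : component i (component i x) = component i x.
Proof. by rewrite (component_hom i (component_in i x)) eqxx. Qed.

Lemma component_eq0 x : (forall i, component i x = 0) -> x = 0.
Proof. by move=> x0; have [s ->] := component_sum x; rewrite big1. Qed.

Lemma direct_sum_span (S : set W) : subspace S ->
  (forall i, U i `<=` S) -> forall x, S x.
Proof.
move=> sS US x; have [s ->] := component_sum x.
by apply: subspace_sum => // i _; apply: US; exact: component_in.
Qed.

Lemma graded_subset N : subspace N ->
  N `<=` sumspace (fun i => U i `&` N) <->
  forall i x, N x -> N (component i x).
Proof.
move=> sN; have [subU _ _] := dU.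
split=> [NU i x /NU[s [f [us Uf ->]]]|Nc x Nx].
  rewrite (lin_sum (component_linear i)) big_seq; apply: subspace_sum => // j js.
  have [Uj Nj] := Uf j js; rewrite (component_hom i Uj).
  by case: eqP => // _; case: sN.
have [s ->] := component_sum x; apply: subspace_sum => [|i _].
  by apply: sumspace_subspace => i; exact: subspaceI.
by apply: (@sumspace_in _ _ _ _ i); split; [exact: component_in|exact: Nc].
Qed.

Lemma direct_sum_regroup (J : choiceType) (phi : I -> J) :
  direct_sum (fun j => [set x | forall i, phi i != j -> component i x = 0]).
Proof.
have sub j : subspace [set x | forall i, phi i != j -> component i x = 0].
  split=> [i _|a x y hx hy i ij]; first exact: lin0 (component_linear i).
  by rewrite component_linear hx // hy // scaler0 addr0.
split=> //.
- apply/seteqP; split=> // x _; have [s ->] := component_sum x.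
  apply: subspace_sum => [|i _]; first exact: sumspace_subspace.
  apply: (@sumspace_in _ _ _ _ (phi i)) => k /eqP ki.
  rewrite (component_hom k (component_in i x)).
  by case: eqP => // kE; rewrite kE in ki.
- move=> s f us sf s0 j js; apply: component_eq0 => i.
  have [ij|] := eqVneq (phi i) j; last exact: sf.
  have := lin0 (component_linear i); rewrite -{1}s0 (lin_sum (component_linear i)).
  rewrite (bigD1_seq j) //= big_seq_cond big1 ?addr0 //.
  by move=> k /andP[ks kj]; apply: sf => //; rewrite ij eq_sym.
Qed.

End Components.

Section AdmissibleModules.
Context {R : realType} {V : vosa R} {g : aut V} {T T' : nat}.
Context (M : admissible_twisted g T T').
Local Notation C := R[i].

Let dM : direct_sum (@mgr _ _ _ _ _ M) := proj1 (mgr_grading M).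

Definition degree : rat -> M -> M := component dM.

(** With the degree projections among the operators, being graded becomes an invariance condition,
    and admissible submodules are exactly the invariant subspaces. *)
Definition mode_ops : set (M -> M) :=
  [set f | (exists v n, f = mY v n) \/ exists n, f = degree n].

Lemma mode_ops_linear f : mode_ops f -> linear f.
Proof.
by move=> [[v [n ->]]|[n ->]]; [exact: mY_linr|exact: component_linear].
Qed.

Lemma admissible_invariant N : admissible_submodule N <-> invariant mode_ops N.
Proof.
split=> [[sN NY NU]|[sN iN]].
  split=> // f [[v [n ->]]|[n ->]] x Nx; first exact: NY.
  by have /(graded_subset dM sN) := NU; apply.
split=> // [v n w Nw|]; first by apply: iN => //; left; exists v, n.
by apply/(graded_subset dM sN) => n x; apply: iN; right; exists n.
Qed.

Lemma irreducible_invariant N : irreducible_submodule N <-> irreducible mode_ops N.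
Proof.
by split=> -[/admissible_invariant aN N0 irr]; split=> // N' /admissible_invariant;
  apply: irr.
Qed.

Lemma degree_mode d (v : V) m n (x : M) : vgr d v ->
  degree n (mY v m x) = mY v m (degree (n - (d - m - 1)) x).
Proof.
move=> Vv; apply: subr0_eq; move: x; apply: (direct_sum_span dM).
  apply: (subspace_preimage (f := fun x => degree n (mY v m x) -
     mY v m (degree (n - (d - m - 1)) x)) _ (@subspace_set0 _ _)).
  apply: linear_sub.
    by apply: (linear_comp (component_linear dM n)); exact: mY_linr.
  by apply: (linear_comp (mY_linr _ _)); exact: component_linear.
move=> k x Mx /=; rewrite /degree (component_hom dM _ (mgr_Y m Vv Mx)).
rewrite (component_hom dM _ Mx).
have -> : (n == k + d - m - 1) = (n - (d - m - 1) == k).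
  by apply/eqP/eqP => E; lra.
by case: eqP => _; rewrite ?subrr // (lin0 (mY_linr v m)) subrr.
Qed.

Lemma completely_reducible_complemented :
  (forall U, invariant mode_ops U -> exists U', complements mode_ops U U') ->
  completely_reducible M.
Proof.
move=> /(direct_sum_irreducible mode_ops_linear)[I [N [irrN dN]]].
by exists I, N; split=> // i; apply/irreducible_invariant.
Qed.

Lemma complemented_completely_reducible : completely_reducible M ->
  forall U, invariant mode_ops U -> exists U', complements mode_ops U U'.
Proof.
move=> [I [N [irrN [_ sN _]]]].
apply: sum_irreducible_complement sN; first exact: mode_ops_linear.
by move=> i; apply/irreducible_invariant.
Qed.

(* The degree-preserving part of q is still a module projection onto U, and its
   kernel is graded. *)
Lemma graded_complement (U : set M) (q : M -> M) : invariant mode_ops U ->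
  linear q -> (forall v n w, q (mY v n w) = mY v n (q w)) ->
  (forall w, U (q w)) -> (forall w, U w -> q w = w) ->
  exists U', complements mode_ops U U'.
Proof.
move=> [sU iU] lq qY qU qid.
have Udeg n x : U x -> U (degree n x) by apply: iU; right; exists n.
pose q0 n x := degree n (q (degree n x)).
have lq0 n : linear (q0 n).
  apply: (linear_comp (component_linear dM n)); apply: (linear_comp lq).
  exact: component_linear.
exists [set x | forall n, q0 n x = 0]; split.
- split; first split.
  + by move=> n; exact: lin0 (lq0 n).
  + by move=> a x y hx hy n; rewrite lq0 hx hy scaler0 addr0.
  + move=> f [[v [m ->]]|[m ->]] x hx n; last first.
      rewrite /q0 /degree (component_hom dM _ (component_in dM m x)).
      case: eqP => [->|_]; first exact: hx.
      by rewrite (lin0 lq) (lin0 (component_linear dM n)).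
    move: v; apply: vgr_span.
      apply: (subspace_preimage (f := fun v => q0 n (mY v m x)) _ (@subspace_set0 _ _)).
      by apply: (linear_comp (lq0 n)); exact: mY_linl.
    move=> d v Vv /=; rewrite /q0 (degree_mode _ _ _ Vv) qY (degree_mode _ _ _ Vv).
    by rewrite -/(q0 _ x) hx (lin0 (mY_linr v m)).
- move=> x Ux hx; apply: (component_eq0 (dU := dM)) => n.
  have := hx n; rewrite /q0 qid; last exact: Udeg.
  by rewrite /degree component_id.
apply/seteqP; split=> // x _; have [s xE] := component_sum dM x.
(* Each degree is to be counted once in [y], the degree-preserving part of q applied to x. Degrees
   outside s contribute nothing, since x has no component there. *)
pose s' := undup s.
have [sM _ _] := dM.
pose y := \sum_(n <- s') q0 n x.
have q0U n z : U (q0 n z) by apply: Udeg; exact: qU.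
exists y, (x - y); split; last by rewrite addrC subrK.
  by apply: subspace_sum.
move=> n; rewrite (linB (lq0 n)); apply/eqP; rewrite subr_eq0; apply/eqP.
have q0q0 k : q0 n (q0 k x) = if k == n then q0 n x else 0.
  rewrite {1}/q0 /degree (component_hom dM _ (component_in dM k _)) eq_sym.
  case: eqP => [->|_]; first by rewrite qid; [exact: component_id|exact: q0U].
  by rewrite (lin0 lq) (lin0 (component_linear dM n)).
rewrite /y (lin_sum (lq0 n)); under eq_bigr do rewrite q0q0.
rewrite -big_mkcond.
have [ns|ns] := boolP (n \in s').
  by rewrite -big_filter filter_pred1_uniq ?undup_uniq // big_seq1.
rewrite big_seq_cond big1 => [|k /andP[ks /eqP kn]]; last first.
  by rewrite -kn ks in ns.
rewrite /q0 /degree xE (lin_sum (component_linear dM n)) big_seq big1.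
  by rewrite (lin0 lq) (lin0 (component_linear dM n)).
move=> k ks; rewrite (component_hom dM _ (component_in dM k _)).
case: eqP => // nk; exfalso; move/negP: ns; apply.
by rewrite nk mem_undup.
Qed.

End AdmissibleModules.
Arguments mode_ops {R V g T T'} M _.

(** * Twisted modules restricted to V^G *)

Section Restriction.
Context {R : realType} {V : vosa R} {G : set (aut V)} {g : aut V} (Gg : G g).
Context {T T' : nat} (M : admissible_twisted g T T').
Local Notation C := R[i].
Local Notation VG := (fixed_vosa G).

(** For T = 1 every integer r names the eigenvalue 1, so an untwisted module must satisfy the
    identity for all of them, while fixed vectors are used in M with r = 0. An integer shift only
    reindexes the sum over n. *)
Lemma mulK_delta10_shift (X : lmodType C) (F : rat -> rat -> rat -> X) al (z : int) a b c :
  mulK (delta10 (al + z%:~R)) F a b c = mulK (delta10 al) F a b c.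
Proof.
rewrite /mulK [RHS](reindex_fsbigT (fun p : int * nat => (p.1 - z, p.2))).
  apply: eq_fsbigr => -[n k] _; rewrite /delta10 /=.
  by have -> : n%:~R - (al + z%:~R) = (n - z)%:~R - al :> rat by rewrite intrB; ring.
exists (fun p : int * nat => (p.1 + z, p.2)) => -[n k] /=; congr (_, _); ring.
Qed.

Lemma fixed_eigen (v : VG) : g (fval v) = @root_exp R 0 T *: fval v.
Proof. by rewrite root_exp0 scale1r; have /fixedP := fvalP v; apply. Qed.

Lemma mY_fixed_nonint (v : VG) n (w : M) : n \isn't a Num.int -> mY (fval v) n w = 0.
Proof.
move=> nn; apply: mY_eigen (fixed_eigen v) _ _ _.
by rewrite /in_coset mul0r subr0; exact/negP.
Qed.

Definition restriction : weak_twisted (id_aut VG) 1.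
Proof.
apply: (@WeakTwisted R VG (id_aut VG) 1 M (fun v n w => mY (fval v) n w)).
- by move=> n w a u v; rewrite fval_linear; exact: mY_linl.
- by move=> v n; exact: mY_linr.
- by move=> v n w; rewrite mul1r; exact: mY_fixed_nonint.
- by move=> v w; exact: mY_trunc.
- by move=> n w; exact: mY_vac.
- move=> r u _ n w; rewrite /in_coset divr1 => /negP nr.
  apply: mY_fixed_nonint; apply: contra nr => ni.
  by rewrite rpredB // intr_int.
move=> r i j u v _ pu pv w a b c; rewrite divr1.
have := mY_jacobi (w0 := M) (fixed_eigen u) (fparity pu) (fparity pv) w a b c.
by rewrite mul0r -(mulK_delta10_shift _ _ r) add0r.
Defined.

Context (S : nat) (S0 : (0 < S)%N).
Hypothesis wtS : forall d (v : VG), vgr d v -> v = 0 \/ S%:R * d \is a Num.int.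

(* M is graded by (1/T')Z but the restriction only may be graded by (1/S)Z, so
   degrees are rounded down. *)
Let rnd (n : rat) : rat := (Num.floor (S%:R * n))%:~R / S%:R.

Let rndD n s : S%:R * s \is a Num.int -> rnd (n + s) = rnd n + s.
Proof.
move=> sS; have Sq : (S%:R : rat) != 0 by rewrite pnatr_eq0 -lt0n.
rewrite /rnd mulrDr real_floorDrz ?num_real // intrD mulrDl; congr (_ + _).
by move: sS => /intrP[z sE]; rewrite sE intrKfloor -sE mulrC mulKf.
Qed.

Let gr (q : rat) : set restriction :=
  [set x : M | forall n, rnd n != q -> degree n x = 0].

Let gr_grading : grading [set n | exists k : nat, n = k%:R / S%:R] gr.
Proof.
have [dM zM] := mgr_grading M.
split; first exact: (direct_sum_regroup (proj1 (mgr_grading M)) rnd).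
move=> q nq x xq; apply: (component_eq0 (dU := dM)) => n.
have [nE|] := eqVneq (rnd n) q; last first.
  move=> /xq; rewrite /degree.
  by rewrite (_ : proj1 (mgr_grading M) = dM) //; exact: Prop_irrelevance.
apply: (zM n); last exact: component_in.
move=> [k kE]; apply: nq; exists `|Num.floor (S%:R * n)|%N.
rewrite -nE /rnd; congr (_ / _).
rewrite -[RHS]/((`|Num.floor (S%:R * n)|%N%:Z)%:~R) gez0_abs // floor_ge0.
by rewrite kE mulr_ge0 // divr_ge0.
Qed.

Let gr_Y (d : rat) (v : VG) (m n : rat) (w : restriction) :
  vgr d v -> gr n w -> gr (n + d - m - 1) (mY v m w).
Proof.
move=> Vv wn k kn; rewrite -[mY v m w]/(mY (fval v) m (w : M)).
rewrite (degree_mode _ _ _ (Vv : vgr d (fval v))).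
have [mi|nm] := boolP (m \is a Num.int); last by rewrite mY_fixed_nonint.
have [->|dS] := wtS Vv.
  by rewrite (lin0 (fval_linear (S := G))) (lin0 (mY_linl m _)).
rewrite wn ?(lin0 (mY_linr _ _)) //.
apply: contraNneq kn => <-.
have sS : S%:R * (d - m - 1) \is a Num.int.
  by rewrite !mulrBr mulr1 !rpredB // ?natr_int // rpredM // natr_int.
by rewrite -[X in rnd X == _](subrK (d - m - 1) k) rndD //; apply/eqP; ring.
Qed.

Definition graded_restriction : admissible_twisted (id_aut VG) 1 S :=
  Admissible gr_grading gr_Y.

(** A homogeneous component for the original grading is homogeneous for the rounded one, so graded
    subspaces stay graded. *)
Lemma restriction_invariant (U : set M) : invariant (mode_ops M) U ->
  invariant (mode_ops graded_restriction) (U : set graded_restriction).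
Proof.
move=> [sU iU]; apply/admissible_invariant; split=> //.
  by move=> v n w Uw; apply: iU => //; left; exists (fval v), n.
move=> x Ux; have [s xE] := component_sum (proj1 (mgr_grading M)) x.
rewrite [x]xE; apply: subspace_sum.
  by apply: sumspace_subspace => q; apply: subspaceI => //;
     have [[] ] := gr_grading.
move=> n _; apply: (@sumspace_in _ _ _ _ (rnd n)); split.
  move=> k kn; rewrite /degree (component_hom _ _ (component_in _ n x)).
  by case: eqP => // kE; rewrite kE eqxx in kn.
by apply: iU => //; right; exists n.
Qed.

End Restriction.

Section Orders.
Context {R : realType} (V : vosa R).
Implicit Type g : aut V.

Lemma finite_order (X : Type) (f : X -> X) n :
  (0 < n)%N -> iter n f =1 id -> exists m, is_order f m.
Proof.
move=> n0 fn.
have ex : exists m, (0 < m)%N && `[< iter m f =1 id >].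
  by exists n; rewrite n0; apply/asboolP.
case: (ex_minnP ex) => m /andP[m0 /asboolP fm] min.
exists m; split=> // k /andP[k0 km] fk.
have := min k; rewrite k0 /= leqNgt km /=.
by move=> H; have : false by apply: H; apply/asboolP.
Qed.

Lemma parity_decomp (v : V) : exists a b,
  [/\ parity (@vgr R V) false a, parity (@vgr R V) true b & v = a + b].
Proof.
move: v; apply: parity_span.
  split; first by exists 0, 0; rewrite addr0; split=> //; exact: parity0.
  move=> c _ _ [a [b [pa pb ->]]] [a' [b' [pa' pb' ->]]].
  exists (c *: a + a'), (c *: b + b'); split; try exact: parity_lin.
  by rewrite scalerDr addrACA.
move=> [] v pv; [exists 0, v|exists v, 0]; rewrite ?add0r ?addr0; split=> //;
  exact: parity0.
Qed.

Lemma sigma_decomp (a b : V) :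
  parity (@vgr R V) false a -> parity (@vgr R V) true b -> sigma (a + b) = a - b.
Proof.
move=> pa pb; apply: xget_unique; first by exists a, b.
move=> x [a' [b' [pa' pb' E ->]]].
have aa : a - a' = 0.
  apply: parity_disj.
    by rewrite addrC -scaleN1r; exact: parity_lin.
  have -> : a - a' = -1 *: b + b'.
    by apply/eqP; rewrite scaleN1r subr_eq -addrA [b' + a']addrC -E addrC addrK.
  exact: parity_lin.
have {}aa := subr0_eq aa; rewrite -aa in E *.
by have /addrI -> := E.
Qed.

Lemma sigmaK : involutive (@sigma R V).
Proof.
move=> v; have [a [b [pa pb ->]]] := parity_decomp v.
have pb' : parity (@vgr R V) true (- b).
  by apply: subspaceN => //; exact: parity_subspace.
by rewrite sigma_decomp // sigma_decomp // opprK.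
Qed.

Lemma sigma_aut g v : sigma (g v) = g (sigma v).
Proof.
have [a [b [pa pb ->]]] := parity_decomp v.
rewrite (linD (aut_linear g)) !sigma_decomp //; try exact: aut_parity.
by rewrite (linB (aut_linear g)).
Qed.

(** sigma commutes with g and is an involution, so the power 2 T of g sigma is trivial. *)
Lemma sigma_aut_order g T : (0 < T)%N -> iter T g =1 id ->
  exists T', is_order (g \o @sigma R V) T'.
Proof.
move=> T0 gT; apply: (@finite_order _ _ (T * 2)); first by rewrite muln_gt0 T0.
move=> v; have -> : iter (T * 2) (g \o @sigma R V) v = iter (T * 2) g v.
  rewrite !iterM; apply: eq_iter => w /=.
  by rewrite sigma_aut sigmaK.
by rewrite mulnC iterM /= gT gT.
Qed.

(** sigma is an involution, so S is 1 or 2, and S = 1 makes odd vectors equal to their opposites.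
    The alternative v = 0 is there because 0 lies in every graded piece. *)
Lemma sigma_order_weight S : is_order (id \o @sigma R V) S ->
  forall d (v : V), vgr d v -> v = 0 \/ S%:R * d \is a Num.int.
Proof.
move=> [S0 Sid Smin] d v Vv; have [_ zV] := vgr_grading V.
have [dd|nd] := boolP (2%:R * d \is a Num.int); last first.
  by left; apply: (zV d _ v Vv); apply/negP.
have [S1|S1] := eqVneq S 1%N; last first.
  suff -> : S = 2%N by right.
  apply/eqP; rewrite eqn_leq; apply/andP; split; last by lia.
  rewrite leqNgt; apply/negP => S2; apply: (Smin 2%N) => // w.
  exact: sigmaK.
have [j c] := half_int_coset dd; have pv := coset_parity c Vv.
case: j c pv => c pv; [left|right]; last first.
  by move: c; rewrite /in_coset S1 mul1r mul0r subr0.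
have := Sid v; rewrite S1 /= (sigma_parity pv) expr1 scaleN1r => /eqP.
by rewrite eq_sym -addr_eq0 -mulr2n -scaler_nat scaler_eq0 pnatr_eq0 => /eqP.
Qed.

End Orders.

Lemma iter_rho (R : realType) (V : vosa R) (gT : finGroupType) (rho : gT -> aut V) :
  (forall x y, rho (x * y)%g =1 rho x \o rho y) ->
  forall x n, iter n (rho x) =1 rho (x ^+ n)%g.
Proof.
move=> rhoM x; elim=> [|n IH] v /=; first by rewrite expg0 (rho1 rhoM).
by rewrite IH expgS rhoM.
Qed.

(** The projection along a complement U' over V^G. Both U and U' are stable under the modes of V^G,
    so it commutes with them; U' need not be stable under V. *)
Lemma complement_projection (R : realType) (V : vosa R) (G : set (aut V))
    (g : aut V) (T T' S : nat) (M : admissible_twisted g T T')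
    (Gg : G g) (S0 : (0 < S)%N)
    (wtS : forall d (v : fixed_vosa G), vgr d v -> v = 0 \/ S%:R * d \is a Num.int)
    (U : set M) :
  completely_reducible (graded_restriction Gg M S0 wtS) ->
  invariant (mode_ops M) U ->
  exists p : M -> M, [/\ linear p,
    forall v, v \in fixed G -> forall n w, p (mY v n w) = mY v n (p w),
    forall w, U (p w) & forall w, U w -> p w = w].
Proof.
move=> redM iU; have [sU iU'] := iU.
have [U' [[sU' iU''] disj sumT]] :=
  complemented_completely_reducible redM (restriction_invariant Gg S0 wtS iU).
have /choice[p Hp] (x : M) : exists u : M, U u /\ U' (x - u).
  have [u [u' [Uu U'u' ->]]] : addset U U' x by rewrite sumT.
  by exists u; split=> //; rewrite addrAC subrr add0r.
have pE x u : U u -> U' (x - u) -> p x = u.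
  move=> Uu U'u; have [Up U'p] := Hp x; apply: subr0_eq; apply: disj.
    exact: (subspaceB sU).
  have -> : p x - u = (x - u) - (x - p x).
    by rewrite opprB [RHS]addrC addrA subrK.
  exact: (subspaceB sU').
exists p; split.
- move=> a x y; apply: pE.
    by case: sU => _; apply; [case: (Hp x)|case: (Hp y)].
  have -> : a *: x + y - (a *: p x + p y) = a *: (x - p x) + (y - p y).
    by rewrite scalerBr opprD addrACA.
  by case: sU' => _; apply; [case: (Hp x)|case: (Hp y)].
- move=> v fv n w; have [Up U'p] := Hp w; apply: pE.
    by apply: iU' => //; left; exists v, n.
  rewrite -(linB (mY_linr v n)).
  by apply: (iU'' _ _ _ U'p); left; exists (FixedPts fv), n.
- by move=> w; case: (Hp w).
- by move=> w Uw; apply: pE => //; rewrite subrr; case: sU'.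
Qed.

Theorem theorem4p1 (R : realType) (V : vosa R) (G : set (aut V)) :
  simple_vosa V -> finite_solvable_subgroup G -> rational_vosa (fixed_vosa G) ->
  forall g : aut V, G g -> g_rational g.
Proof.
move=> sV [gT0 [H [rho0 [_ rho0M rho0_inj GE]]]] [S1 [S [ord1 ordS redG]]] g Gg.
(* The group H is made into a type, so that the homomorphism and injectivity hypotheses hold without
   membership conditions. *)
pose rho (x : subg_of H) := rho0 (sgval x).
have rhoM x y : rho (x * y)%g =1 rho x \o rho y.
  by apply: rho0M; exact: subgP.
have rho_inj x y : rho x =1 rho y -> x = y.
  by move=> E; apply: val_inj; apply: rho0_inj E; exact: subgP.
have Grho h : G h -> exists x, h = rho x.
  by rewrite GE => -[x Hx <-]; exists (subg H x); rewrite /rho subgK.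
have [x0 gE] := Grho g Gg.
have [|T ordT] := @finite_order _ g #[x0]%g (order_gt0 x0).
  by move=> v; rewrite gE (iter_rho rhoM) expg_order (rho1 rhoM).
have [T0 gT _] := ordT.
have [T' ordT'] := sigma_aut_order T0 gT.
exists T, T'; split=> // M; apply: completely_reducible_complemented => U iU.
(* The order of the identity in the definition of rationality is only given existentially; its
   minimality pins it down. *)
have S11 : S1 = 1%N.
  case: ord1 => S10 _ min1; apply/eqP; rewrite eqn_leq S10 andbT leqNgt.
  by apply/negP => /(min1 1%N); apply.
subst S1; have [S0 _ _] := ordS.
have [p [lp pG pU pid]] := complement_projection (redG
  (graded_restriction Gg M S0 (sigma_order_weight ordS))) iU.
have [sU iU'] := iU.
have UY v n w : U w -> U (mY v n w) by apply: iU'; left; exists v, n.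
have pV v : (forall h, rho h v = v) -> forall n w, p (mY v n w) = mY v n (p w).
  by move=> fv; apply: pG; apply/fixedP => h /Grho[x ->].
have [q [lq qY qU qid]] :=
  linear_projection sV rhoM rho_inj T0 gT lp pV sU UY pU pid.
exact: graded_complement lq qY qU qid.
Qed.
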